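(* Suppose that the parameters $p,r,s,t,v$ satisfy $0<p<t\le s<\infty$, $0<r\le\infty$, $0<v\le1$, $v<\min(p,r)$. Assume that $\{Q_j\}_{j=1}^\infty\subset\mathcal{Q}(\mathbb{R}^n)$, $\{a_j\}_{j=1}^\infty\subset\mathrm{W}\mathcal{M}^s_t(\mathbb{R}^n)$ and $\{\lambda_j\}_{j=1}^\infty\subset[0,\infty)$ fulfill $$\|a_j\|_{\mathrm{W}\mathcal{M}^s_t}\le|Q_j|^{\frac1s},\quad\mathrm{supp}(a_j)\subset Q_j\quad(j\in\mathbb{N}),\qquad\left\|\left(\sum_{j=1}^\infty(\lambda_j\chi_{Q_j})^v\right)^{\frac1v}\right\|_{L^{p,r}}<\infty.$$ Then $f=\sum_{j=1}^\infty\lambda_ja_j$ converges a.e. and satisfies $$\|f\|_{L^{p,r}}\le C\left\|\left(\sum_{j=1}^\infty(\lambda_j\chi_{Q_j})^v\right)^{\frac1v}\right\|_{L^{p,r}},$$ where $C>0$ depends only on $n,p,r,s,t,v$. In particular, $f=\sum_{j=1}^\infty\lambda_ja_j$ converges in $L^{p,r}(\mathbb{R}^n)$ if $r<\infty$.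
   Context: $L^0(\mathbb{R}^n)$ is the set of all measurable functions on $\mathbb{R}^n$, $\mathcal{Q}(\mathbb{R}^n)$ is the family of all cubes in $\mathbb{R}^n$ with sides parallel to the coordinate axes, $|E|$ is Lebesgue measure, and $\chi_E$ is the indicator function of $E$. For measurable $f$ put $\lambda_f(\alpha)=|\{x:|f(x)|>\alpha\}|$ ($\alpha>0$) and $f^\ast(t)=\inf\{\alpha>0:\lambda_f(\alpha)\le t\}$ ($t>0$). The Lorentz quasi-norm is $\|f\|_{L^{p,r}}=\left(\int_0^\infty(t^{1/p}f^\ast(t))^r\frac{dt}{t}\right)^{1/r}$ for $0<p,r<\infty$ and $\|f\|_{L^{p,\infty}}=\sup_{t>0}t^{1/p}f^\ast(t)$; $L^{p,r}(\mathbb{R}^n)$ is the set of measurable $f$ with finite quasi-norm. For $0<t\le s<\infty$, the Morrey quasi-norm is $\|f\|_{\mathcal{M}^s_t}=\sup_{Q\in\mathcal{Q}(\mathbb{R}^n)}|Q|^{\frac1s-\frac1t}\|f\chi_Q\|_{L^t}$, and the weak Morrey space $\mathrm{W}\mathcal{M}^s_t(\mathbb{R}^n)$ is the set of $f\in L^0(\mathbb{R}^n)$ with $\|f\|_{\mathrm{W}\mathcal{M}^s_t}=\sup_{\lambda>0}\lambda\|\chi_{\{x\in\mathbb{R}^n:|f(x)|>\lambda\}}\|_{\mathcal{M}^s_t}<\infty$. *)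

(* Defs.v *)
From HB Require Import structures.
From mathcomp Require Import all_boot all_order all_algebra.
From mathcomp Require Import all_classical all_reals all_analysis.
From mathcomp Require Import complex.
Set Implicit Arguments.
Unset Strict Implicit.
Unset Printing Implicit Defensive.
Import Order.TTheory GRing.Theory Num.Theory.
Import numFieldNormedType.Exports.
Local Open Scope classical_set_scope.
Local Open Scope ring_scope.

Section borel_lebesgue_step.
Context {R : realType} {n : nat}.
Context (m : {sigma_finite_measure set (n.-tuple (measurableTypeR R)) -> \bar R}).

Definition cons_pair (z : measurableTypeR R * n.-tuple (measurableTypeR R)) :
    n.+1.-tuple (measurableTypeR R) :=
  [the n.+1.-tuple _ of z.1 :: z.2].

Lemma measurable_cons_pair : measurable_fun [set: _] cons_pair.
Proof. by apply: measurable_cons. Qed.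

Definition leb_step : set (n.+1.-tuple (measurableTypeR R)) -> \bar R :=
  pushforward (lebesgue_measure \x m)%E cons_pair.

Let leb_step_measure : {measure set (n.+1.-tuple (measurableTypeR R)) -> \bar R} :=
  measure_function_pushforward__canonical__measure_function_Measure
    (lebesgue_measure \x m)%E measurable_cons_pair.

Let leb_step0 : leb_step set0 = 0%E.
Proof. exact: (measure0 leb_step_measure). Qed.

Let leb_step_ge0 A : (0 <= leb_step A)%E.
Proof. exact: (measure_ge0 leb_step_measure). Qed.

Let leb_step_sigma_additive : semi_sigma_additive leb_step.
Proof. exact: (@measure_semi_sigma_additive _ _ _ leb_step_measure). Qed.

HB.instance Definition _ := isMeasure.Build _ _ _
  leb_step leb_step0 leb_step_ge0 leb_step_sigma_additive.

Let leb_step_sigma_finite : sigma_finite setT leb_step.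
Proof.
have /sigma_finiteP[F [FT Fnd Foo]] := sigma_finiteT (@lebesgue_measure R).
have /sigma_finiteP[G [GT Gnd Goo]] := sigma_finiteT m.
pose un (x : n.+1.-tuple (measurableTypeR R)) :
  measurableTypeR R * n.-tuple (measurableTypeR R) :=
  (tnth x ord0, [tuple of behead x]).
have mun : measurable_fun [set: _] un.
  apply: measurable_fun_pair => /=; first exact: measurable_tnth.
  exact: measurable_behead.
exists (fun k => un @^-1` (F k `*` G k)).
  rewrite -preimage_bigcup (_ : \bigcup_k _ = setT) ?preimage_setT//.
  apply/seteqP; split=> // -[x y] _.
  have [i _ Fi] : (\bigcup_i F i) x by rewrite -FT.
  have [j _ Gj] : (\bigcup_i G i) y by rewrite -GT.
  exists (maxn i j) => //; split=> /=.
    by move: Fi; exact/subsetPset/Fnd/leq_maxl.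
  by move: Gj; exact/subsetPset/Gnd/leq_maxr.
move=> k; have [mF Fk] := Foo k; have [mG Gk] := Goo k; split.
  by rewrite -[X in measurable X]setTI; apply: mun => //; exact: measurableX.
rewrite /leb_step /pushforward -comp_preimage (_ : un \o cons_pair = id).
  rewrite preimage_id product_measure1E//.
  by rewrite lte_mul_pinfty// ge0_fin_numE.
by apply/funext => -[a t] /=; congr pair; exact: val_inj.
Qed.

HB.instance Definition _ :=
  Measure_isSigmaFinite.Build _ _ _ leb_step leb_step_sigma_finite.

End borel_lebesgue_step.

(* n-fold product of the Lebesgue measure of the line, on Borel sets. *)
Fixpoint borel_leb {R : realType} (n : nat) :
    {sigma_finite_measure set (n.-tuple (measurableTypeR R)) -> \bar R} :=
  match n with
  | 0 => [the {sigma_finite_measure set (0.-tuple (measurableTypeR R)) -> \bar R} of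
            \d_([tuple] : 0.-tuple (measurableTypeR R))]
  | n'.+1 => [the {sigma_finite_measure set (n'.+1.-tuple (measurableTypeR R)) -> \bar R} of
                leb_step (borel_leb n')]
  end.

(* R^n with the Lebesgue sigma-algebra: the Caratheodory sets of the outer
   measure induced by [borel_leb]. *)
Definition Rn (R : realType) (n : nat) : Type :=
  caratheodory_type (borel_leb (R:=R) n)^*%mu.

Section lebesgue_measure_Rn.
Context {R : realType} (n : nat).

HB.instance Definition _ := Measurable.on (Rn R n).

Definition leb : set (Rn R n) -> \bar R :=
  @completed_measure_extension _ _ R (borel_leb n).

Let leb0 : leb set0 = 0%E.
Proof. exact: (measure0 (@completed_measure_extension _ _ R (borel_leb n))). Qed.

Let leb_ge0 A : (0 <= leb A)%E.
Proof. exact: (measure_ge0 (@completed_measure_extension _ _ R (borel_leb n))). Qed.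

Let leb_sigma_additive : semi_sigma_additive leb.
Proof.
exact: (@measure_semi_sigma_additive _ _ _
  (@completed_measure_extension _ _ R (borel_leb n))).
Qed.

HB.instance Definition _ := isMeasure.Build _ _ _
  leb leb0 leb_ge0 leb_sigma_additive.

Let leb_sigma_finite : sigma_finite setT leb.
Proof. exact/completed_measure_extension_sigma_finite/sigma_finiteT. Qed.

HB.instance Definition _ :=
  Measure_isSigmaFinite.Build _ _ _ leb leb_sigma_finite.

End lebesgue_measure_Rn.

Definition coord {R : realType} {n : nat} (x : Rn R n) (i : 'I_n) : R :=
  tnth (x : n.-tuple R) i.

(* Nondegenerate cubes; each edge may contain or omit each of its endpoints. *)
Definition is_cube {R : realType} {n : nat} (Q : set (Rn R n)) : Prop :=
  exists (c : 'I_n -> R) (l : R) (b b' : 'I_n -> bool),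
    0 < l /\
    Q = [set x | forall i,
      coord x i \in Interval (BSide (b i) (c i)) (BSide (b' i) (c i + l))].

Section function_spaces.
Context {R : realType} {n : nat}.
Local Notation mu := (@leb R n).
Implicit Types (f : Rn R n -> R[i]) (g : Rn R n -> \bar R).

Definition L0 f : Prop :=
  measurable_fun [set: Rn R n] (fun x => complex.Re (f x)) /\
  measurable_fun [set: Rn R n] (fun x => complex.Im (f x)).

Definition modulus f : Rn R n -> \bar R := fun x => (Normc.normc (f x))%:E.

(* Support of a measurable function defined up to null sets: the complement of
   the largest open set on which the function vanishes almost everywhere. *)
Definition supp f : set (Rn R n) :=
  ~` [set x | exists2 e : R, 0 < e &
    {ae mu, forall y, (forall i, `|coord y i - coord x i| < e) -> f y = 0}].

(* The quasi-norms only depend on the modulus; they are defined on functions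
   with values in [\bar R] so as to apply to series of nonnegative terms. *)
Local Open Scope ereal_scope.

Definition distribution_function g (alpha : R) : \bar R :=
  mu [set x | alpha%:E < `|g x|].

Definition rearrangement g (t : R) : \bar R :=
  ereal_inf [set alpha%:E | alpha in
    [set alpha : R | (0 < alpha)%R /\ distribution_function g alpha <= t%:E]].

Definition lorentz_norm (p : R) (r : \bar R) g : \bar R :=
  match r with
  | r'%:E =>
      (\int[lebesgue_measure]_(t in `]0%R, +oo[)
         (((t `^ p^-1)%:E * rearrangement g t) `^ r' * (t^-1)%:E)) `^ r'^-1
  | +oo => ereal_sup [set (t `^ p^-1)%:E * rearrangement g t | t in
             [set t : R | (0 < t)%R]]
  | -oo => 0
  end.

Definition morrey_norm (s t : R) g : \bar R :=
  ereal_sup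
    [set mu Q `^ (s^-1 - t^-1) * 'N[mu]_(t%:E)[(fun x => g x * (\1_Q x)%:E)]
    | Q in [set Q | is_cube Q]].

Definition weak_morrey_norm (s t : R) g : \bar R :=
  ereal_sup [set lambda%:E *
      morrey_norm s t (fun x => (\1_[set y | (lambda%:E < `|g y|)%E] x)%:E)
    | lambda in [set lambda : R | (0 < lambda)%R]].

Definition weak_morrey (s t : R) f : Prop :=
  L0 f /\ weak_morrey_norm s t (modulus f) < +oo.

Definition lorentz (p : R) (r : \bar R) f : Prop :=
  L0 f /\ lorentz_norm p r (modulus f) < +oo.

(* (\sum_j (lambda_j chi_(Q_j))^v)^(1/v) *)
Definition cube_sum (v : R) (lambda : nat -> R) (Q : nat -> set (Rn R n)) :
    Rn R n -> \bar R :=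
  fun x => (\sum_(0 <= j <oo) ((lambda j * \1_(Q j) x) `^ v)%:E) `^ v^-1.

End function_spaces.

Definition partial_sum {R : realType} {n : nat} (lambda : nat -> R)
    (a : nat -> Rn R n -> R[i]) (N : nat) (x : Rn R n) : R[i] :=
  \sum_(j < N) (lambda j)%:C%C * a j x.

(* Main.v *)
(** The atoms enter only through their weak L^t size: testing the Morrey norm on
    [Q_j] gives |{|a_j| > l}| <= |Q_j| l^-t, and a_j = 0 a.e. off Q_j. As v <= 1,
    |sum_j lambda_j a_j| is at most g = (sum_j (lambda_j |a_j|)^v)^(1/v). Put
    F = sum_j (lambda_j chi_(Q_j))^v, G = g^v, and fix q with p/v < q < t/v. The
    heart of the matter is that, for a suitable constant kappa,
      |{F > 2^-i b}| <= kappa 2^(iq) tau for all i   implies   |{G > b}| <= tau.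
    Discard the union E* of the cubes at least half covered by E = {F > b}; it is
    small by Vitali's covering lemma. For A in {G > b} off E*, the integral of G
    over A is bounded by that of F (M chi_A)^(1 - v/t) off E, M being the maximal
    function along the cubes Q_j. Kolmogorov's inequality, used once for the atoms
    and once for M, and a dyadic decomposition of F (here q < t/v) then yield
    |A| <= C |A|^(1 - v/t) (kappa tau)^(v/t).
    For rearrangements, the implication says that g*(tau) is at most the supremum
    over i of 2^(i/v) f*(kappa 2^(iq) tau) with f = F^(1/v). Since dt/t is scale
    invariant and q > p/v, these dilations sum geometrically in L^(p,r).
    Convergence in L^(p,r) follows by applying the bound to the tails of the series. *)
Require Import Defs.
From HB Require Import structures.
From mathcomp Require Import all_boot all_order all_algebra.
From mathcomp Require Import all_classical all_reals all_analysis.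
From mathcomp Require Import complex.
From mathcomp Require Import measurable_realfun ring lra.
Set Implicit Arguments.
Unset Strict Implicit.
Unset Printing Implicit Defensive.
Import Order.TTheory GRing.Theory Num.Theory.
Import numFieldNormedType.Exports.
Local Open Scope classical_set_scope.
Local Open Scope ring_scope.

(** * Cubes and the covering lemma *)

(** Stated on Borel tuples, where product measures compute the volume; [measurable_Rn] and [leb_box]
    transfer the results to [Rn]. *)
Definition box (R : realType) (n : nat) (I : 'I_n -> interval R) :
  set (n.-tuple (measurableTypeR R)) :=
  [set x | forall i, (tnth x i : R) \in I i].

Lemma measurable_box (R : realType) n (I : 'I_n -> interval R) :
  measurable (box I).
Proof.
have -> : box I = \bigcap_(i in [set: 'I_n])
    ((fun x : n.-tuple (measurableTypeR R) => tnth x i) @^-1` [set` I i]).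
  by apply/seteqP; split => [x Ix i _|x Ix i]; [exact: Ix|exact: (Ix i Logic.I)].
apply: fin_bigcap_measurable => // i _.
rewrite -[X in measurable X]setTI; exact: measurable_tnth.
Qed.

Lemma borel_leb_box (R : realType) n (I : 'I_n -> interval R) :
  borel_leb n (box I) = (\prod_(i < n) lebesgue_measure [set` I i])%E.
Proof.
elim: n I => [|n IH] I.
  rewrite big_ord0 /= diracE mem_set// => -[].
  by [].
rewrite big_ord_recl -IH /= /leb_step /pushforward.
rewrite -product_measure1E; [|exact: measurable_itv|exact: measurable_box].
congr (_ _); apply/seteqP; split => -[a x] /=.
  move=> Ix; split; first exact: (Ix ord0).
  by move=> i /=; have := Ix (lift ord0 i); rewrite /cons_pair/= tnthS.
move=> [/= aI xI] i; rewrite /cons_pair /=.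
case: (unliftP ord0 i) => [j ->|->]; last by rewrite tnth0.
by rewrite tnthS; exact: xI.
Qed.

Lemma measurable_Rn (R : realType) n (A : set (n.-tuple (measurableTypeR R))) :
  measurable A -> measurable (A : set (Rn R n)).
Proof. exact: caratheodory_measurable_mu_ext. Qed.

Lemma leb_box (R : realType) n (I : 'I_n -> interval R) :
  leb (box I : set (Rn R n)) = (\prod_(i < n) lebesgue_measure [set` I i])%E.
Proof.
rewrite -borel_leb_box /leb /completed_measure_extension.
by rewrite measurable_mu_extE//; exact: measurable_box.
Qed.

Lemma leb_cube_box (R : realType) n (c : 'I_n -> R) (l : R) (b b' : 'I_n -> bool) :
  0 < l ->
  leb (box (fun i => Interval (BSide (b i) (c i)) (BSide (b' i) (c i + l)))
    : set (Rn R n)) = (l ^+ n)%:E.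
Proof.
move=> l0; rewrite leb_box.
under eq_bigr do rewrite lebesgue_measure_itv/= lte_fin ltrDl l0 -EFinD addrAC subrr add0r.
by rewrite prodEFin prodr_const card_ord.
Qed.

Lemma measurable_cube (R : realType) n (Q : set (Rn R n)) :
  is_cube Q -> measurable Q.
Proof.
by move=> [c [l [b [b' [l0 ->]]]]]; apply: measurable_Rn; exact: measurable_box.
Qed.

Lemma leb_cubeE (R : realType) n (Q : set (Rn R n)) :
  is_cube Q -> exists2 l : R, 0 < l & leb Q = l%:E.
Proof.
move=> [c [l [b [b' [l0 ->]]]]]; exists (l ^+ n); first exact: exprn_gt0.
exact: leb_cube_box.
Qed.

(** The closed cube with the same centre and three times the edge works: in each coordinate, a point
    of [Q'] is within the edge of [Q] of a common point of both cubes. Edges compare as volumes do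
    because [n > 0]. *)
Lemma cube_tripling (R : realType) n (Q : set (Rn R n)) : (0 < n)%N ->
  is_cube Q -> exists W : set (Rn R n), [/\ measurable W,
    leb W = ((3 ^+ n)%:E * leb Q)%E &
    forall Q', is_cube Q' -> (leb Q' <= leb Q)%E -> Q `&` Q' !=set0 ->
      Q' `<=` W].
Proof.
move=> n0 [c [l [b [b' [l0 ->]]]]].
exists (box (fun i => Interval (BSide true (c i - l)) (BSide false (c i - l + 3 * l)))).
split; first by apply: measurable_Rn; exact: measurable_box.
  rewrite (leb_cube_box (fun i => c i - l) (fun=> true) (fun=> false)) ?mulr_gt0//.
  by rewrite exprMn EFinM (leb_cube_box c b b' l0).
move=> _ [c' [l' [d [d' [l'0 ->]]]]].
rewrite (leb_cube_box c b b' l0) (leb_cube_box c' d d' l'0) lee_fin.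
rewrite ler_pXn2r ?nnegrE; [|exact: n0|exact: ltW|exact: ltW].
move=> l'l [z [/= Qz Q'z]] y /= Q'y i.
have := Q'y i; have := Qz i; have := Q'z i.
rewrite -![tnth _ i]/(Defs.coord _ i); move: (Defs.coord z i) (Defs.coord y i) => u w.
rewrite !itv_boundlr !bnd_simp.
(* Whichever endpoints the edges contain, only the non-strict inequalities are kept. *)
have le_side e (x0 x1 : R) : (BSide e x0 <= BLeft x1)%O -> x0 <= x1.
  by case: e; rewrite !bnd_simp// => /ltW.
have ge_side e (x0 x1 : R) : (BRight x0 <= BSide e x1)%O -> x0 <= x1.
  by case: e; rewrite !bnd_simp// => /ltW.
move=> /andP[/le_side ? /ge_side ?] /andP[/le_side ? /ge_side ?].
by move=> /andP[/le_side ? /ge_side ?]; apply/andP; split; lra.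
Qed.

Section vitali.
Context d (T : measurableType d) (R : realType) (mu : {measure set T -> \bar R}).
Variables (Q W : nat -> set T) (K c : R) (A : set T).
Hypotheses (mQ : forall i, measurable (Q i)) (mW : forall i, measurable (W i)).
Hypotheses (K0 : 0 <= K) (c0 : 0 <= c) (mA : measurable A).
Hypothesis WK : forall i, (mu (W i) <= K%:E * mu (Q i))%E.
Hypothesis QW : forall i j, (mu (Q j) <= mu (Q i))%E -> Q i `&` Q j !=set0 ->
  Q j `<=` W i.
Hypothesis Q0 : forall i, Q i !=set0.
Local Open Scope ereal_scope.

(** The sets selected below are disjoint; of this only the resulting measure inequality is recorded,
    in a form to which one more disjoint set can be added. *)
Let covering (s : seq nat) (D : seq nat) :=
  [/\ {subset D <= s},
    \big[setU/set0]_(i <- s) Q i `<=` \big[setU/set0]_(i <- D) W i &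
    c%:E * mu (\big[setU/set0]_(i <- D) W i) <=
      K%:E * mu (A `&` \big[setU/set0]_(i <- D) Q i)].

(** Greedy selection, by induction on a list sorted by increasing measure, so that the larger sets
    are treated first. If the head meets a selected set, it is no larger and lies in the enlargement
    of that set. Otherwise it is selected too: the left side of the inequality is subadditive, the
    right side additive. *)
Let vitali_sorted (s : seq nat) :
  sorted (fun i j => mu (Q i) <= mu (Q j)) s ->
  (forall i, i \in s -> c%:E * mu (Q i) <= mu (A `&` Q i)) ->
  exists D, covering s D.
Proof.
elim: s => [_ _|i s IH /= ps cs].
  by exists [::]; split; rewrite ?big_nil// setI0 measure0 !mule0.
have [D [Ds sD cD]] := IH (path_sorted ps) (fun j js => cs j (mem_behead (s := i :: s) js)).
have mQD : measurable (\big[setU/set0]_(j <- D) Q j) by exact: bigsetU_measurable.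
have mWD : measurable (\big[setU/set0]_(j <- D) W j) by exact: bigsetU_measurable.
have [[k [kD ik]]|Ni] := pselect (exists k, k \in D /\ Q k `&` Q i !=set0).
  exists D; split => //; first by move=> j /Ds js; rewrite inE js orbT.
  rewrite big_cons subUset; split => //.
  have iW : Q i `<=` W k.
    apply: QW => //.
    have /allP := order_path_min (fun _ _ _ => @le_trans _ _ _ _ _) ps.
    by apply; exact: Ds.
  apply: (subset_trans iW); rewrite -bigcup_seq => x Wx.
  by exists k.
exists (i :: D); rewrite /covering !big_cons; split.
- by move=> j; rewrite !inE => /orP[->//|/Ds ->]; rewrite orbT.
- apply: setUSS => //; apply: QW => //.
  by rewrite setIid.
- apply: (@le_trans _ _ (c%:E * (mu (W i) + mu (\big[setU/set0]_(j <- D) W j)))).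
    apply: lee_wpmul2l; first by rewrite lee_fin.
    exact: measureU2.
  rewrite setIUr measureU//; last 3 first.
  - exact: measurableI.
  - exact: measurableI.
  - rewrite setIACA (_ : Q i `&` _ = set0) ?setI0//.
    apply/seteqP; split => // x [Qx]; rewrite -bigcup_seq => -[k /= kD Qkx].
    by apply: Ni; exists k; split => //; exists x.
  rewrite !ge0_muleDr//; apply: leeD => //.
  apply: (@le_trans _ _ (c%:E * (K%:E * mu (Q i)))).
    by apply: lee_wpmul2l; rewrite ?lee_fin.
  rewrite muleCA; apply: lee_wpmul2l; first by rewrite lee_fin.
  by apply: cs; rewrite mem_head.
Qed.

(* Only a sequence of sets is considered, so that the superlevel set of the
   maximal function is a countable union. *)
Lemma vitali_weak_type (J : set nat) :
  (forall i, J i -> c%:E * mu (Q i) <= mu (A `&` Q i)) ->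
  c%:E * mu (\bigcup_(i in J) Q i) <= K%:E * mu A.
Proof.
move=> cJ.
pose J' i := if `[<J i>] then Q i else set0.
have mJ' i : measurable (J' i) by rewrite /J'; case: ifP.
have -> : \bigcup_(i in J) Q i = \bigcup_i J' i.
  rewrite bigcup_mkcond; apply: eq_bigcupr => i _; rewrite /J'.
  by case: (pselect (J i)) => Ji; [rewrite mem_set// asboolT|rewrite memNset// asboolF].
(* Continuity from below reduces the claim to finitely many sets, which are then sorted by
   measure. *)
have cvgJ : mu (\big[setU/set0]_(i < n.+1) J' i) @[n --> \oo] --> mu (\bigcup_i J' i).
  have := @nondecreasing_cvg_mu _ _ _ mu (fun n => \big[setU/set0]_(i < n.+1) J' i).
  rewrite bigcup_bigsetU_bigcup; apply.
  - by move=> n; exact: bigsetU_measurable.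
  - by rewrite -bigcup_bigsetU_bigcup; apply: bigcup_measurable => n _; exact: bigsetU_measurable.
  - by move=> m n mn; apply/subsetPset; exact: subset_bigsetU.
rewrite -(cvg_lim _ cvgJ)// -limeMl//; last first.
  by apply/cvg_ex; eexists; exact: cvgJ.
apply: lime_le; first by apply: is_cvgeMl => //; apply/cvg_ex; eexists; exact: cvgJ.
apply: nearW => n.
pose le i j := mu (Q i) <= mu (Q j).
pose s := sort le [seq i <- iota 0 n.+1 | `[<J i>]].
have ss : sorted le s by apply: sort_sorted => i j; exact: le_total.
have [|D [Ds sD cD]] := vitali_sorted ss.
  by move=> i; rewrite mem_sort mem_filter => /andP[/asboolP Ji _]; exact: cJ.
have mWD : measurable (\big[setU/set0]_(j <- D) W j) by exact: bigsetU_measurable.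
apply: (@le_trans _ _ (c%:E * mu (\big[setU/set0]_(j <- D) W j))).
  apply: lee_wpmul2l; first by rewrite lee_fin.
  apply: le_measure; rewrite ?inE//; first exact: bigsetU_measurable.
  apply: subset_trans sD; rewrite -bigcup_mkord -bigcup_seq => x [i /= ilt].
  rewrite /J'; case: ifPn => // Ji Qx; exists i => //=.
  by rewrite mem_sort mem_filter Ji mem_iota.
apply: (le_trans cD); apply: lee_wpmul2l; first by rewrite lee_fin.
apply: le_measure; rewrite ?inE//.
by apply: measurableI => //; exact: bigsetU_measurable.
Qed.

End vitali.

(** * Weak-type inequalities *)

Lemma exp2_unbounded (R : archiRealFieldType) (y : R) : exists n : nat, y < 2 ^+ n.
Proof.
exists (Num.truncn y).+1; apply: (lt_trans (truncnS_gt y)).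
by rewrite -natrX ltr_nat ltn_expl.
Qed.

Lemma dyadic_above (R : archiRealFieldType) (h y : R) : 0 < h -> h < y ->
  exists i : nat, h * 2 ^+ i < y <= h * 2 ^+ i.+1.
Proof.
move=> h0 hy; have [n yn] := exp2_unbounded (y / h).
have P : exists i : nat, y <= h * 2 ^+ i.+1.
  exists n; rewrite mulrC -ler_pdivrMr// (le_trans (ltW yn))//.
  by rewrite ler_weXn2l// ler1n.
case: (ex_minnP P) => i yi min_i; exists i; rewrite yi andbT.
case: i yi min_i => [|i] yi min_i; first by rewrite expr0 mulr1.
by rewrite ltNge; apply/negP => /min_i; rewrite ltnn.
Qed.

Lemma dyadic_below (R : archiRealFieldType) (h y : R) : 0 < y -> y <= h ->
  exists i : nat, h / 2 ^+ i.+1 < y <= h / 2 ^+ i.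
Proof.
move=> y0 yh; have [n yn] := exp2_unbounded (h / y).
have e0 i : 0 < 2 ^+ i :> R by rewrite exprn_gt0.
have P : exists i : nat, h / 2 ^+ i.+1 < y.
  exists n; rewrite ltr_pdivrMr// -ltr_pdivrMl// mulrC (lt_le_trans yn)//.
  by rewrite ler_weXn2l// ler1n.
case: (ex_minnP P) => i yi min_i; exists i; rewrite yi /=.
case: i yi min_i => [|i] yi min_i; first by rewrite expr0 divr1.
by rewrite leNgt; apply/negP => /min_i; rewrite ltnn.
Qed.

Lemma nneseries_geometric (R : realType) (a z : R) : 0 <= z < 1 ->
  (\sum_(0 <= i <oo) (a * z ^+ i)%:E = (a / (1 - z))%:E)%E.
Proof.
move=> /andP[z0 z1]; apply/cvg_lim => //.
under eq_fun do rewrite sumEFin.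
apply: cvg_EFin; first exact: nearW.
by apply: cvg_geometric_series; rewrite ger0_norm.
Qed.

Lemma nneseries_ge (R : realType) (u : nat -> \bar R) (k : nat) :
  (forall i, 0 <= u i)%E -> (u k <= \sum_(0 <= i <oo) u i)%E.
Proof.
move=> u0; apply: le_trans (nneseries_lim_ge k.+1 _) => //.
by rewrite big_nat_recr//= leeDr// sume_ge0.
Qed.

Lemma powR_exprn (R : realType) (x r : R) i : 0 <= x ->
  (x ^+ i) `^ r = (x `^ r) ^+ i.
Proof.
move=> x0; elim: i => [|i IH]; first by rewrite !expr0 powR1.
by rewrite !exprS powRM ?exprn_ge0// IH.
Qed.

Lemma powR2_gt1 (R : realType) (x : R) : 0 < x -> 1 < 2 `^ x.
Proof.
move=> x0; have : (1 : R) `^ x < 2 `^ x.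
  by apply: gt0_ltr_powR; rewrite ?nnegrE ?ltr1n.
by rewrite powR1.
Qed.

Lemma powR2_lt1 (R : realType) (x : R) : x < 0 -> 0 <= (2 `^ x : R) < 1.
Proof.
move=> x0; rewrite powR_ge0 -(opprK x) powRN invf_lt1 ?powR_gt0//=.
by rewrite powR2_gt1// oppr_gt0.
Qed.

Section weak_type.
Context d (T : measurableType d) (R : realType) (mu : {measure set T -> \bar R}).
Local Open Scope ereal_scope.

Lemma measurable_nneseries (D : set T) (g : nat -> T -> \bar R) :
  (forall i x, D x -> 0 <= g i x) -> (forall i, measurable_fun D (g i)) ->
  measurable_fun D (fun x => \sum_(0 <= i <oo) g i x).
Proof.
by move=> g0 mg; apply: (@ge0_emeasurable_sum _ _ _ D g xpredT) => // k x Dx _; exact: g0.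
Qed.

Lemma measurable_superlevel (h : T -> R) (a : R) :
  measurable_fun [set: T] h -> measurable [set x | (a < h x)%R].
Proof.
move=> mh; rewrite -[X in measurable X]setTI.
rewrite (_ : [set x | _] = h @^-1` [set` `]a, +oo[%R]).
  by apply: mh => //; exact: measurable_itv.
by apply/seteqP; split => x /=; rewrite in_itv/= andbT.
Qed.

Lemma measurable_esuperlevel (h : T -> \bar R) (a : \bar R) :
  measurable_fun [set: T] h -> measurable [set x | a < h x].
Proof.
by move=> mh; rewrite -[X in measurable X]setTI; exact: emeasurable_fun_o_infty.
Qed.

(** Kolmogorov's inequality for a function in weak L^s, on sets of measure at most [m]. As a
    predicate on the constant, it can be passed to [maximal_power] with the constant fixed before
    the function and the set. *)
Definition kolmogorov_constant (s C : R) : Prop :=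
  forall (h : T -> R) (M m : R) (D : set T),
    measurable_fun [set: T] h -> (0 < M)%R ->
    (forall a : R, (0 < a)%R -> mu [set x | (a < h x)%R] <= (M * a `^ (- s))%:E) ->
    measurable D -> mu D <= m%:E -> (forall x, D x -> 0 <= h x)%R ->
    \int[mu]_(x in D) (h x)%:E <= (C * M `^ s^-1 * m `^ (1 - s^-1))%:E.

(** At the height [h1 = (M/m)^(1/s)] the weak bound equals [m]. Below it [h] contributes at most
    [h1 m]; the layer between [h1 2^i] and [h1 2^(i+1)] contributes at most [2 h1 m z^i], where
    [z = 2^(1-s) < 1]. This is the right size, as [h1 m = M^(1/s) m^(1-1/s)]. *)
Lemma kolmogorov_inequality (s : R) : (1 < s)%R ->
  exists2 C : R, (0 < C)%R & kolmogorov_constant s C.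
Proof.
move=> s1; have s0 : (0 < s)%R by exact: lt_trans s1.
pose z : R := (2 `^ (1 - s))%R.
have z01 : (0 <= z < 1)%R by apply: powR2_lt1; rewrite subr_lt0.
have [z0 z1] := andP z01.
exists (1 + 2 / (1 - z))%R.
  by rewrite addr_gt0// divr_gt0// subr_gt0.
move=> h M m D mh M0 weak mD Dm h0.
have mhD : measurable_fun D (EFin \o h).
  by apply/measurable_EFinP; exact: measurable_funTS.
have : (0 <= m)%R by rewrite -lee_fin (le_trans _ Dm).
(* For [m = 0] the set [D] is null; [h1] is positive only for [m > 0]. *)
rewrite le_eqVlt => /predU1P[m0|m0].
  rewrite null_set_integral//; last first.
    by apply/eqP; rewrite eq_le measure_ge0 andbT (le_trans Dm)// -m0.
  by rewrite lee_fin !mulr_ge0 ?powR_ge0// addr_ge0// divr_ge0// subr_ge0 ltW.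
pose h1 := ((M / m) `^ s^-1)%R.
have h1_gt0 : (0 < h1)%R by rewrite powR_gt0 ?divr_gt0.
have e0 i : (0 < h1 * 2 ^+ i :> R)%R by rewrite mulr_gt0// exprn_gt0.
pose L i := [set x | (h1 * 2 ^+ i < h x)%R].
have mL i : measurable (L i) by exact: measurable_superlevel.
pose g i x := (h1 * 2 ^+ i.+1)%:E * (\1_(L i) x)%:E.
have g0 i x : 0 <= g i x by rewrite mule_ge0// lee_fin// ltW.
have mg i : measurable_fun D (g i).
  by apply: measurable_funeM; apply/measurable_EFinP; exact: measurable_indic.
have hg x : D x -> (h x)%:E <= h1%:E + \sum_(0 <= i <oo) g i x.
  move=> Dx; have [hh1|h1h] := leP (h x) h1.
    by rewrite -[leLHS]adde0 leeD// ?lee_fin// nneseries_ge0.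
  have [i /andP[hi ih]] := dyadic_above h1_gt0 h1h.
  apply: (@le_trans _ _ (g i x)).
    by rewrite /g indicE mem_set// mule1 lee_fin.
  apply: (@le_trans _ _ (\sum_(0 <= j <oo) g j x)).
    by apply: (@nneseries_ge _ (fun j => g j x)) => j; exact: g0.
  by rewrite leeDr// lee_fin ltW.
apply: (@le_trans _ _ (\int[mu]_(x in D) (h1%:E + \sum_(0 <= i <oo) g i x))).
  apply: ge0_le_integral => //.
  apply: emeasurable_funD => //.
  exact: measurable_nneseries.
rewrite ge0_integralD//; last 3 first.
- by move=> x _; rewrite lee_fin ltW.
- by move=> x _; exact: nneseries_ge0.
- exact: measurable_nneseries.
rewrite integral_cst// integral_nneseries//.
have hm : (h1 * m = M `^ s^-1 * m `^ (1 - s^-1))%R.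
  rewrite /h1 powRM// ?invr_ge0 ?ltW// -mulrA; congr *%R.
  rewrite -[(m^-1)%R]powR_inv1 ?ltW// -powRrM mulN1r -[X in (_ * X)%R = _](powRr1 (ltW m0)).
  by rewrite -powRD ?(gt_eqF m0) ?implybT// addrC.
have gi i : \int[mu]_(x in D) g i x <= (2 * h1 * m * z ^+ i)%:E.
  rewrite ge0_integralZl//; last 2 first.
  - by apply/measurable_EFinP; exact: measurable_indic.
  - by rewrite lee_fin ltW.
  rewrite integral_indic//.
  apply: (@le_trans _ _ ((h1 * 2 ^+ i.+1)%:E * (M * (h1 * 2 ^+ i) `^ (- s))%:E)).
    apply: lee_wpmul2l; first by rewrite lee_fin ltW.
    apply: (le_trans _ (weak _ (e0 i))); apply: le_measure; rewrite ?inE//.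
      exact: measurableI.
    exact: measurable_superlevel.
  rewrite -EFinM lee_fin powRM; [|exact: ltW|exact: exprn_ge0].
  have -> : (M * (h1 `^ (- s) * (2 ^+ i) `^ (- s)) = m * (2 ^+ i) `^ (- s))%R.
    rewrite mulrA; congr *%R; rewrite /h1 -powRrM mulrN mulVf ?gt_eqF//.
    rewrite powR_inv1 ?divr_ge0 ?ltW// invf_div mulrCA divff ?mulr1//.
    by rewrite gt_eqF.
  have -> : (z ^+ i = 2 ^+ i * (2 ^+ i) `^ (- s))%R.
    rewrite /z powRD ?pnatr_eq0 ?implybT// powRr1// exprMn; congr *%R.
    by rewrite powR_exprn.
  by rewrite exprS le_eqVlt; apply/orP; left; apply/eqP; ring.
apply: (@le_trans _ _ ((h1 * m)%:E + \sum_(0 <= i <oo) (2 * h1 * m * z ^+ i)%:E)).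
  apply: leeD.
    by rewrite EFinM; apply: lee_wpmul2l => //; rewrite lee_fin ltW.
  by apply: lee_nneseries => // i *; apply: integral_ge0 => x _.
rewrite nneseries_geometric// -EFinD lee_fin -[leRHS]mulrA -hm.
by rewrite le_eqVlt; apply/orP; left; apply/eqP; ring.
Qed.

End weak_type.

Lemma powR_le1 (R : realType) (x p : R) : 0 <= x <= 1 -> 0 <= p -> x `^ p <= 1.
Proof.
move=> /andP[x0 x1] p0; have : x `^ p <= 1 `^ p.
  by apply: ge0_ler_powR; rewrite ?nnegrE.
by rewrite powR1.
Qed.

Section maximal_function.
Context d (T : measurableType d) (R : realType) (mu : {measure set T -> \bar R}).
Variables (K : R) (Q : nat -> set T) (w : nat -> R).
Hypotheses (K0 : 0 < K) (mQ : forall j, measurable (Q j)).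
Hypotheses (w0 : forall j, 0 < w j) (muQ : forall j, mu (Q j) = (w j)%:E).
Hypothesis weak : forall (A : set T) (e : R) (J : set nat), measurable A -> 0 <= e ->
  (forall j, J j -> (e%:E * mu (Q j) <= mu (A `&` Q j))%E) ->
  (e%:E * mu (\bigcup_(j in J) Q j) <= K%:E * mu A)%E.
Local Open Scope ereal_scope.

Let density (A : set T) (j : nat) : R := (fine (mu (A `&` Q j)) / w j)%R.

Let densityE (A : set T) j : measurable A ->
  (density A j * w j)%:E = mu (A `&` Q j).
Proof.
move=> mA; rewrite /density mulfVK ?gt_eqF// fineK// ge0_fin_numE//.
apply: (@le_lt_trans _ _ (mu (Q j))); last by rewrite muQ ltry.
by apply: le_measure; rewrite ?inE//; exact: measurableI.
Qed.

Let density_ge0 A j : (0 <= density A j)%R.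
Proof. by rewrite divr_ge0 ?fine_ge0// ltW. Qed.

Let density_le1 A j : measurable A -> (density A j <= 1)%R.
Proof.
move=> mA; rewrite -(ler_pM2r (w0 j)) mul1r -lee_fin densityE// -muQ.
by apply: le_measure; rewrite ?inE//; exact: measurableI.
Qed.

(** [H] is the power [th = 1 - 1/s] of the maximal function of the indicator of [A] along the sets
    [Q j]. The covering inequality [weak] bounds the maximal function in weak L^1, so [H] lies in
    weak L^(1/th). As [1/th > 1], Kolmogorov's inequality bounds its integrals over sets of finite
    measure, with the exponent [1 - th = 1/s]. *)
Lemma maximal_power (s C : R) (A : set T) (a : R) :
  (1 < s)%R -> kolmogorov_constant mu (1 - s^-1)^-1 C ->
  measurable A -> (0 < a)%R -> mu A = a%:E ->
  exists H : T -> R, [/\ measurable_fun [set: T] H, (forall x, 0 <= H x)%R,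
    forall j x, Q j x -> (density A j `^ (1 - s^-1) <= H x)%R &
    forall D m, measurable D -> mu D <= m%:E ->
      \int[mu]_(x in D) (H x)%:E <= (C * K `^ (1 - s^-1) * a `^ (1 - s^-1) * m `^ s^-1)%:E].
Proof.
move=> s1 CP mA a0 muA; have s0 : (0 < s)%R by exact: lt_trans s1.
have si : (0 < s^-1 < 1)%R by rewrite invr_gt0 s0 invf_lt1.
have [si0 si1] := andP si.
set th : R := (1 - s^-1)%R in CP *; have th0 : (0 < th)%R by rewrite subr_gt0.
pose u x j : R := (\1_(Q j) x * density A j `^ th)%R.
have u01 x j : (0 <= u x j <= 1)%R.
  rewrite /u mulr_ge0 ?powR_ge0// indicE /= mulr_ile1 ?powR_ge0 ?lern1 ?leq_b1//.
  by apply: powR_le1; [rewrite density_ge0 density_le1|exact: ltW].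
have ubu x : has_ubound (range (u x)).
  by exists 1%R => _ [j _ <-]; case/andP: (u01 x j).
(* [sups] from index 0 is the supremum over all [j], finite since densities are at most 1. *)
pose H x : R := sups (u x) 0%N.
have uH x j : (u x j <= H x)%R.
  by apply: ub_le_sup; [exact/has_ubound_sdrop|exists j].
have mH : measurable_fun [set: T] H.
  apply: (@measurable_fun_sups _ _ _ _ (fun j x => u x j) 0%N) => // j.
  by apply: measurable_funM => //; exact: measurable_indic.
have H0 x : (0 <= H x)%R.
  by apply: le_trans (uH x 0%N); case/andP: (u01 x 0%N).
exists H; split => //.
- by move=> j x Qx; have := uH x j; rewrite /u indicE mem_set// mul1r.
have weakH (e : R) : (0 < e)%R ->
    mu [set x | (e < H x)%R] <= (K * a * e `^ (- th^-1))%:E.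
  (* [H x > e] means that [x] lies in some [Q j] of density above [e' = e^(1/th)]. *)
  move=> e0; pose e' : R := (e `^ th^-1)%R.
  have e'0 : (0 < e')%R by rewrite powR_gt0.
  pose J := [set j | (e < density A j `^ th)%R].
  have HJ : [set x | (e < H x)%R] `<=` \bigcup_(j in J) Q j.
    move=> x /= eH; have [|_ [j _ <-] ej] := sup_gt _ eH.
      by exists (u x 0%N); exists 0%N.
    exists j; rewrite /J /=.
      by apply: (lt_le_trans ej); rewrite /u ler_piMl ?powR_ge0.
    apply: contrapT => nQ; move: ej; rewrite /u indicE memNset// mul0r.
    by rewrite ltNge ltW.
  have mHe : measurable [set x | (e < H x)%R] by exact: measurable_superlevel.
  apply: (@le_trans _ _ (mu (\bigcup_(j in J) Q j))).
    by apply: le_measure; rewrite ?inE//; exact: bigcup_measurable.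
  have Jw j : J j -> e'%:E * mu (Q j) <= mu (A `&` Q j).
    move=> /= ej; rewrite muQ -densityE// -EFinM lee_fin.
    rewrite ler_pM2r//; apply/ltW.
    rewrite -[ltRHS](powRr1 (density_ge0 A j)) -(mulfV (lt0r_neq0 th0)) powRrM.
    apply: gt0_ltr_powR => //; rewrite ?invr_gt0// nnegrE ?powR_ge0//.
    exact: ltW.
  have := @weak A e' J mA (ltW e'0) Jw; rewrite muA.
  rewrite powRN -/e' muleC -lee_pdivlMr// => /le_trans; exact.
move=> D m mD Dm.
have := CP H (K * a)%R m D mH (mulr_gt0 K0 a0) weakH mD Dm (fun x _ => H0 x).
by rewrite invrK subKr powRM ?mulrA//; exact: ltW.
Qed.

End maximal_function.

(** * The distributional estimate *)

(** Where [h / 2^(i+1) < F <= h / 2^i], the [i]-th term on the right dominates [F * H]. The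
    integrals on the right run over whole superlevel sets of [F], whose measures are controlled
    later. *)
Lemma integral_dyadic_levels d (T : measurableType d) (R : realType)
    (mu : {measure set T -> \bar R}) (F : T -> \bar R) (H : T -> R) (h : R) :
  0 < h -> (forall x, 0 <= F x)%E -> measurable_fun [set: T] F ->
  (forall x, 0 <= H x) -> measurable_fun [set: T] H ->
  (\int[mu]_(x in ~` [set x | h%:E < F x]) (F x * (H x)%:E) <=
   \sum_(0 <= i <oo) (h / 2 ^+ i)%:E *
     \int[mu]_(x in [set x | (h / 2 ^+ i.+1)%:E < F x]) (H x)%:E)%E.
Proof.
move=> h0 F0 mF H0 mH.
pose L i := [set x | ((h / 2 ^+ i.+1)%:E < F x)%E].
have mL i : measurable (L i) by exact: measurable_esuperlevel.
have mHE D : measurable_fun D (EFin \o H).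
  by apply/measurable_EFinP; exact: measurable_funTS.
have mN : measurable (~` [set x | (h%:E < F x)%E]).
  by apply: measurableC; exact: measurable_esuperlevel.
pose f i x := ((h / 2 ^+ i)%:E * ((fun x => (H x)%:E) \_ (L i)) x)%E.
have h2 i : 0 <= h / 2 ^+ i by rewrite divr_ge0 ?exprn_ge0// ltW.
have f0 i x : (0 <= f i x)%E.
  by rewrite mule_ge0 ?lee_fin// erestrict_ge0// => ? ?; rewrite lee_fin.
have mf i D : measurable D -> measurable_fun D (f i).
  move=> mD; apply: measurable_funeM; apply: measurable_funTS.
  by apply/(measurable_restrictT _ (mL i)); exact: mHE.
apply: (@le_trans _ _ (\int[mu]_x \sum_(0 <= i <oo) f i x)%E); last first.
  rewrite integral_nneseries//; last by move=> i; exact: mf.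
  apply: lee_nneseries => i *; first by apply: integral_ge0 => x _.
  rewrite ge0_integralZl//.
  - by rewrite -integral_mkcond.
  - by apply/(measurable_restrictT _ (mL i)); exact: mHE.
  - by move=> x _; rewrite erestrict_ge0// => ? ?; rewrite lee_fin.
  - by rewrite lee_fin.
rewrite integral_mkcond; apply: ge0_le_integral => //.
- move=> x _; apply: erestrict_ge0 => y _; rewrite mule_ge0//.
  by rewrite lee_fin.
- apply/(measurable_restrictT _ mN); apply: emeasurable_funM => //.
  exact: measurable_funTS.
- by apply: measurable_nneseries => // i; exact: mf.
move=> x _; rewrite patchE; case: ifPn; last by move=> _; exact: nneseries_ge0.
rewrite inE/= => /negP; rewrite -leNgt.
have := F0 x; rewrite le_eqVlt => /predU1P[<- _|].
  by rewrite mul0e; exact: nneseries_ge0.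
case Fx : (F x) => [y| |]//; rewrite lte_fin lee_fin => y0 yh.
have [i /andP[iy yi]] := dyadic_below y0 yh.
apply: (@le_trans _ _ (f i x)); last first.
  by apply: (@nneseries_ge _ (fun j => f j x)) => j; exact: f0.
rewrite /f patchE mem_set; last by rewrite /L/= Fx lte_fin.
by rewrite -!EFinM lee_fin ler_wpM2r.
Qed.

Section off_exceptional_set.
Context d (T : measurableType d) (R : realType).
Variable mu : {sigma_finite_measure set T -> \bar R}.
Variables (Q : nat -> set T) (w : nat -> R).
Hypotheses (mQ : forall j, measurable (Q j)).
Hypotheses (w0 : forall j, 0 < w j) (muQ : forall j, mu (Q j) = (w j)%:E).
Variables (b : nat -> T -> R) (s : R) (c : nat -> R).
Hypothesis c0 : forall j, 0 <= c j.
Hypothesis mb : forall j, measurable_fun [set: T] (b j).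
Hypotheses (b0 : forall j x, 0 <= b j x) (bQ : forall j x, ~ Q j x -> b j x = 0).
Local Open Scope ereal_scope.

Let F x := \sum_(0 <= j <oo) (c j * \1_(Q j) x)%:E.
Let G x := \sum_(0 <= j <oo) (c j * b j x)%:E.

Let mF : measurable_fun [set: T] F.
Proof.
apply: measurable_nneseries => [j x _|j]; first by rewrite lee_fin mulr_ge0.
by apply/measurable_EFinP; apply: measurable_funM => //; exact: measurable_indic.
Qed.

(* H bounds the power [1 - 1/s] of the maximal function of the indicator of A.
   The integral of [b j] over A is at most [C1 w_j (|A n Q_j| / w_j)^(1 - 1/s)],
   hence at most [C1 w_j H] on [Q j]; and if A meets [Q j], then more than half
   of [Q j] lies off E, so that [w_j <= 2 |Q_j \ E|]. *)
Lemma integral_off_exceptional (C1 beta : R) (A : set T) (H : T -> R) :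
  (0 <= C1)%R ->
  let E := [set x | beta%:E < F x] in
  (forall j D m, measurable D -> mu D <= m%:E ->
    \int[mu]_(x in D) (b j x)%:E <= (C1 * w j `^ s^-1 * m `^ (1 - s^-1))%:E) ->
  measurable A -> measurable_fun [set: T] H -> (forall x, 0 <= H x)%R ->
  (forall j x, Q j x -> (fine (mu (A `&` Q j)) / w j) `^ (1 - s^-1) <= H x)%R ->
  (forall j, 2^-1%:E * mu (Q j) <= mu (E `&` Q j) -> A `&` Q j = set0) ->
  \int[mu]_(x in A) G x <= (2 * C1)%:E * \int[mu]_(x in ~` E) (F x * (H x)%:E).
Proof.
move=> C10 E Cb mA mH H0 QH AQ.
have mE : measurable E by exact: measurable_esuperlevel.
have mE' : measurable (~` E) by exact: measurableC.
have mHE D : measurable_fun D (EFin \o H).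
  by apply/measurable_EFinP; exact: measurable_funTS.
pose f j x := (c j * \1_(Q j) x)%:E * (H x)%:E.
have f0 j x : 0 <= f j x by rewrite mule_ge0// lee_fin ?mulr_ge0.
have mf j : measurable_fun (~` E) (f j).
  apply: emeasurable_funM => //; apply/measurable_EFinP.
  by apply: measurable_funM => //; exact: measurable_indic.
rewrite /G integral_nneseries//; last 2 first.
- by move=> j; apply/measurable_EFinP; apply: measurable_funTS; exact: measurable_funM.
- by move=> j x _; rewrite lee_fin mulr_ge0.
have -> : \int[mu]_(x in ~` E) (F x * (H x)%:E) =
    \int[mu]_(x in ~` E) (\sum_(0 <= j <oo) f j x).
  apply: eq_integral => x _; rewrite /F muleC -nneseriesZl; last first.
    by move=> j _; rewrite lee_fin mulr_ge0.
  by apply: eq_eseriesr => j _; rewrite muleC.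
rewrite integral_nneseries// -nneseriesZl; last by move=> j _; exact: integral_ge0.
(* The two series are compared term by term; on each side the integral reduces to [Q j]. *)
apply: lee_nneseries => j *.
  by apply: integral_ge0 => x _; rewrite lee_fin mulr_ge0.
have -> : \int[mu]_(x in A) (c j * b j x)%:E =
    (c j)%:E * \int[mu]_(x in A `&` Q j) (b j x)%:E.
  rewrite integral_mkcondr -ge0_integralZl//; last 3 first.
  - apply/measurable_restrict => //.
    by apply/measurable_EFinP; exact: measurable_funTS.
  - by move=> x _; apply: erestrict_ge0 => ? ?; rewrite lee_fin.
  - by rewrite lee_fin.
  apply: eq_integral => x _; rewrite patchE EFinM.
  by case: ifPn => // /negP xQ; rewrite bQ// => Qx; apply: xQ; rewrite inE.
have -> : \int[mu]_(x in ~` E) f j x =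
    (c j)%:E * \int[mu]_(x in ~` E `&` Q j) (H x)%:E.
  rewrite integral_mkcondr -ge0_integralZl//; last 3 first.
  - by apply/measurable_restrict => //; exact: mHE.
  - by move=> x _; apply: erestrict_ge0 => ? ?; rewrite lee_fin.
  - by rewrite lee_fin.
  apply: eq_integral => x _; rewrite patchE /f indicE.
  by case: ifPn; rewrite ?mulr1 ?mulr0 ?mul0e ?mule0.
rewrite muleCA; apply: lee_wpmul2l; first by rewrite lee_fin.
(* A set at least half covered by [E] does not meet [A], and its term on the left vanishes. *)
have [half|half] := leP (2^-1%:E * mu (Q j)) (mu (E `&` Q j)).
  rewrite AQ// integral_set0 mule_ge0// ?lee_fin ?mulr_ge0//.
  by apply: integral_ge0 => x _; rewrite lee_fin.
pose r := (fine (mu (A `&` Q j)) / w j)%R.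
have r0 : (0 <= r)%R by rewrite divr_ge0 ?fine_ge0// ltW.
have rE : mu (A `&` Q j) = (r * w j)%:E.
  rewrite /r mulfVK ?gt_eqF// fineK// ge0_fin_numE//.
  apply: (@le_lt_trans _ _ (mu (Q j))); last by rewrite muQ ltry.
  by apply: le_measure; rewrite ?inE//; exact: measurableI.
apply: (@le_trans _ _ (C1 * w j * r `^ (1 - s^-1))%:E).
  have AQr : mu (A `&` Q j) <= (r * w j)%:E by rewrite rE.
  apply: (le_trans (Cb j _ _ (measurableI _ _ mA (mQ j)) AQr)).
  rewrite lee_fin powRM//; last exact: ltW.
  rewrite le_eqVlt; apply/orP; left; apply/eqP.
  have -> : (C1 * w j = C1 * (w j `^ s^-1 * w j `^ (1 - s^-1)))%R.
    by rewrite -powRD ?(gt_eqF (w0 j)) ?implybT// addrC subrK powRr1// ltW.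
  by ring.
apply: (@le_trans _ _ ((2 * C1)%:E * \int[mu]_(x in ~` E `&` Q j) (r `^ (1 - s^-1))%:E)).
  rewrite integral_cst; last exact: measurableI.
  have : (w j / 2)%:E <= mu (~` E `&` Q j).
    have : mu (E `&` Q j) + mu (~` E `&` Q j) = (w j)%:E.
      rewrite -measureU//; last 3 first.
      - exact: measurableI.
      - exact: measurableI.
      - by rewrite setIACA setICr set0I.
      by rewrite -setIUl setUCr setTI; exact: muQ.
    move: half; rewrite muQ -EFinM.
    case: (mu (E `&` Q j)) => [x| |]//; case: (mu (~` E `&` Q j)) => [y| |]//.
    by rewrite -EFinD lte_fin lee_fin => xw [xyw]; lra.
  move=> half'; apply: (@le_trans _ _ ((2 * C1)%:E * ((r `^ (1 - s^-1))%:E * (w j / 2)%:E))).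
    by rewrite -!EFinM lee_fin le_eqVlt; apply/orP; left; apply/eqP; field.
  apply: lee_wpmul2l; first by rewrite lee_fin mulr_ge0.
  by apply: lee_wpmul2l => //; rewrite lee_fin powR_ge0.
apply: lee_wpmul2l; first by rewrite lee_fin mulr_ge0.
apply: ge0_le_integral => //.
- exact: measurableI.
- by move=> x _; rewrite lee_fin powR_ge0.
- by move=> x [_ Qx]; rewrite lee_fin; exact: QH.
Qed.
End off_exceptional_set.

(** Allows [A] to be taken of finite measure, as is required to divide an inequality by a power of
    its measure. The parts of [A] in an increasing exhaustion by sets of finite measure tend to [A]
    in measure. *)
Lemma sigma_finite_mu_le d (T : measurableType d) (R : realType)
    (mu : {sigma_finite_measure set T -> \bar R}) (A : set T) (x : \bar R) :
  measurable A ->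
  (forall B, measurable B -> B `<=` A -> (mu B < +oo)%E -> (mu B <= x)%E) ->
  (mu A <= x)%E.
Proof.
move=> mA hB.
have /sigma_finiteP[X [XT ndX Xoo]] := sigma_finiteT mu.
have mAX k : measurable (A `&` X k) by apply: measurableI => //; case: (Xoo k).
have AE : A = \bigcup_k (A `&` X k) by rewrite -setI_bigcupr -XT setIT.
have cvgA : mu (A `&` X k) @[k --> \oo] --> mu A.
  rewrite [in X in _ --> X]AE; apply: nondecreasing_cvg_mu => //.
    by rewrite -AE.
  by move=> i j ij; apply/subsetPset; apply: setIS; exact/subsetPset/ndX.
rewrite -(cvg_lim _ cvgA)//; apply: lime_le.
  by apply/cvg_ex; eexists; exact: cvgA.
apply: nearW => k.
apply: hB => //; case: (Xoo k) => mX; apply: le_lt_trans.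
by apply: le_measure; rewrite ?inE.
Qed.

(** To be used with [c j = lambda_j^v], [b j = |a_j|^v] and [t/v] for [s], which leaves sums without
    exponents. One half of [tau] bounds the exceptional union [X], the other the part of the
    superlevel set of [G] off [X]. *)
Lemma distribution_estimate d (T : measurableType d) (R : realType)
    (mu : {sigma_finite_measure set T -> \bar R}) (K q s : R) :
  0 < K -> 1 < s -> q < s -> exists2 kappa : R, 0 < kappa &
  forall (Q : nat -> set T) (w c : nat -> R) (b : nat -> T -> R) (beta tau : R),
  (forall j, measurable (Q j)) -> (forall j, 0 < w j) ->
  (forall j, mu (Q j) = (w j)%:E) ->
  (forall (A : set T) (e : R) (J : set nat), measurable A -> 0 <= e ->
    (forall j, J j -> (e%:E * mu (Q j) <= mu (A `&` Q j))%E) ->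
    (e%:E * mu (\bigcup_(j in J) Q j) <= K%:E * mu A)%E) ->
  (forall j, 0 <= c j) ->
  (forall j, measurable_fun [set: T] (b j)) ->
  (forall j x, 0 <= b j x) -> (forall j x, ~ Q j x -> b j x = 0) ->
  (forall j (e : R), 0 < e ->
    (mu [set x | (e < b j x)%R] <= (w j * e `^ (- s))%:E)%E) ->
  0 < beta -> 0 < tau ->
  (forall i : nat,
    (mu [set x | (beta / 2 ^+ i)%:E < \sum_(0 <= j <oo) (c j * \1_(Q j) x)%:E]
      <= (kappa * (2 `^ q) ^+ i * tau)%:E)%E) ->
  (mu [set x | beta%:E < \sum_(0 <= j <oo) (c j * b j x)%:E] <= tau%:E)%E.
Proof.
move=> K0 s1 qs; have s0 : 0 < s by exact: lt_trans s1.
have si0 : 0 < s^-1 by rewrite invr_gt0.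
set th : R := 1 - s^-1; have th0 : 0 < th by rewrite subr_gt0 invf_lt1.
have [C1 C10 kolm] := kolmogorov_inequality mu s1.
(* Ratio of the dyadic sum: halving the level of [F] multiplies the bound on the measure by [2^q],
   which enters with exponent [1/s]. It is below 1 since [q < s]. *)
pose z : R := 2 `^ (q / s - 1).
have /andP[z0 z1] : 0 <= z < 1.
  by apply: powR2_lt1; rewrite subr_lt0 ltr_pdivrMr// mul1r.
have [|C2' C20' kolm2] := kolmogorov_inequality mu (s := th^-1).
  by rewrite invf_gt1// gtrDl oppr_lt0.
pose C2 : R := C2' * K `^ th.
have C20 : 0 < C2 by rewrite mulr_gt0// powR_gt0.
pose C3 : R := 2 * C1 * C2 * 2 `^ (q / s) / (1 - z).
have C30 : 0 < C3.
  by rewrite /C3 divr_gt0 ?subr_gt0// !mulr_gt0// powR_gt0.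
have k0 : 0 < 4 * K + 2 * C3 `^ s by rewrite addr_gt0 ?mulr_gt0// powR_gt0.
(* The summand [4 K] gives [K kappa <= 1/4], hence [mu X <= tau / 2], the covering inequality being
   used at density 1/2. The summand [2 C3^s] gives [C3^s kappa <= 1/2], hence the other [tau / 2],
   since [C3] is the constant in [|A|^(1/s) <= C3 (kappa tau)^(1/s)]. *)
exists (4 * K + 2 * C3 `^ s)^-1; first by rewrite invr_gt0.
set kappa := _^-1 => Q w c b beta tau mQ w0 muQ weak c0 mb b0 bQ weakb beta0 tau0.
have kappa0 : 0 < kappa by rewrite invr_gt0.
set F : T -> \bar R := fun x => (\sum_(0 <= j <oo) (c j * \1_(Q j) x)%:E)%E => levels.
set G : T -> \bar R := fun x => (\sum_(0 <= j <oo) (c j * b j x)%:E)%E.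
have F0 x : (0 <= F x)%E by apply: nneseries_ge0 => j _ _; rewrite lee_fin mulr_ge0.
have mF : measurable_fun [set: T] F.
  apply: measurable_nneseries => [j x _|j]; first by rewrite lee_fin mulr_ge0.
  by apply/measurable_EFinP; apply: measurable_funM => //; exact: measurable_indic.
have mG : measurable_fun [set: T] G.
  apply: measurable_nneseries => [j x _|j]; first by rewrite lee_fin mulr_ge0.
  by apply/measurable_EFinP; exact: measurable_funM.
pose E := [set x | (beta%:E < F x)%E].
have mE : measurable E by exact: measurable_esuperlevel.
(* The sets at least half covered by [E]; their union [X] is the exceptional set. *)
pose J := [set j | (2^-1%:E * mu (Q j) <= mu (E `&` Q j))%E].
pose X := \bigcup_(j in J) Q j.
have mX : measurable X by exact: bigcup_measurable.
have mGb : measurable [set x | (beta%:E < G x)%E] by exact: measurable_esuperlevel.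
have muX : (mu X <= (tau / 2)%:E)%E.
  have h2 : (0 : R) <= 2^-1 by [].
  have := weak E 2^-1 J mE h2 (fun j => id).
  have := levels 0%N; rewrite !expr0 mulr1 divr1 -/E -/X => muE.
  have : (K%:E * mu E <= (tau / 4)%:E)%E.
    apply: (@le_trans _ _ (K%:E * (kappa * tau)%:E)%E).
      by apply: lee_wpmul2l => //; rewrite lee_fin ltW.
    have Kk : K * kappa <= 4^-1.
      rewrite ler_pdivrMr// mulrDr mulrA mulVf ?pnatr_eq0// mul1r lerDl.
      by rewrite !mulr_ge0 ?powR_ge0.
    by rewrite -EFinM lee_fin; have := ler_wpM2r (ltW tau0) Kk; lra.
  move=> /[swap] /le_trans /[apply].
  case: (mu X) => [x| |]//; first by rewrite -EFinM !lee_fin; lra.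
    by rewrite gt0_muley// lte_fin.
  by rewrite leNye.
change (mu [set x | (beta%:E < G x)%E] <= tau%:E)%E.
suff muA : (mu ([set x | (beta%:E < G x)%E] `\` X) <= (tau / 2)%:E)%E.
  apply: (@le_trans _ _ (mu ([set x | (beta%:E < G x)%E] `\` X) + mu X)%E).
    apply: le_trans (measureU2 mu (measurableD mGb mX) mX).
    apply: le_measure; rewrite ?inE//.
      by apply: measurableU => //; exact: measurableD.
    by move=> x Gx; have [Xx|nXx] := pselect (X x); [right|left].
  by rewrite [tau]splitr EFinD leeD.
apply: sigma_finite_mu_le; first exact: measurableD.
move=> A mA AG Aoo.
have := measure_ge0 mu A; rewrite le_eqVlt => /predU1P[<-|].
  by rewrite lee_fin divr_ge0// ltW.
move=> muA0; pose a := fine (mu A).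
have muA : mu A = a%:E by rewrite fineK// ge0_fin_numE.
have a0 : 0 < a by rewrite -lte_fin -muA.
have [H [mH H0 HQ intH]] := maximal_power K0 mQ w0 muQ weak s1 kolm2 mA a0 muA.
(* Chebyshev's inequality, [G] exceeding [beta] on [A]. *)
have : (beta%:E * mu A <= \int[mu]_(x in A) G x)%E.
  rewrite -integral_cst//; apply: ge0_le_integral => //.
  - by move=> x _; rewrite lee_fin ltW.
  - exact: measurable_funTS.
  - by move=> x /AG[/ltW].
have AX j : J j -> A `&` Q j = set0.
  move=> Jj; apply/seteqP; split => // x [/AG[_ nX] Qx]; apply: nX.
  by exists j.
have intb j D m : measurable D -> (mu D <= m%:E)%E ->
    (\int[mu]_(x in D) (b j x)%:E <= (C1 * w j `^ s^-1 * m `^ (1 - s^-1))%:E)%E.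
  by move=> mD Dm; apply: kolm => //; exact: weakb.
move=> /le_trans /(_ (integral_off_exceptional mQ w0 muQ c0 mb b0 bQ
  (ltW C10) intb mA mH H0 HQ AX)).
have levels_sum : (\int[mu]_(x in ~` E) (F x * (H x)%:E) <=
    \sum_(0 <= i <oo)
      (beta * C2 * a `^ th * (kappa * tau) `^ s^-1 * 2 `^ (q / s) * z ^+ i)%:E)%E.
  apply: le_trans (integral_dyadic_levels mu beta0 F0 mF H0 mH) _.
  apply: lee_nneseries => i *.
    apply: mule_ge0; first by rewrite lee_fin divr_ge0 ?exprn_ge0// ltW.
    by apply: integral_ge0 => x _; rewrite lee_fin.
  have mL : measurable [set x | ((beta / 2 ^+ i.+1)%:E < F x)%E].
    exact: measurable_esuperlevel.
  apply: (@le_trans _ _ ((beta / 2 ^+ i)%:E *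
      (C2 * a `^ th * (kappa * (2 `^ q) ^+ i.+1 * tau) `^ s^-1)%:E)%E).
    apply: lee_wpmul2l; first by rewrite lee_fin divr_ge0 ?exprn_ge0// ltW.
    by apply: intH => //; exact: levels.
  rewrite -EFinM lee_fin le_eqVlt; apply/orP; left; apply/eqP.
  have -> : kappa * (2 `^ q) ^+ i.+1 * tau = kappa * tau * (2 `^ q) ^+ i.+1 by ring.
  rewrite powRM ?mulr_ge0 ?exprn_ge0 ?powR_ge0 ?ltW//.
  have -> : ((2 `^ q) ^+ i.+1) `^ s^-1 = 2 `^ (q / s) * (2 `^ (q / s)) ^+ i.
    by rewrite powR_exprn ?powR_ge0// -powRrM exprS.
  have -> : z ^+ i = (2 `^ (q / s)) ^+ i / 2 ^+ i.
    rewrite -expr_div_n /z powRB ?powRr1//; first by rewrite pnatr_eq0 implybT.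
  by field; rewrite expf_neq0.
rewrite -/F => /le_trans/(_ (lee_wpmul2l _ levels_sum)).
rewrite nneseries_geometric ?z0// -!EFinM muA !lee_fin.
move=> /(_ (mulr_ge0 (ler0n _ 2) (ltW C10))) aC.
(* Division by [beta a^(1-1/s)], where [a] is finite and positive. *)
have : a `^ s^-1 <= C3 * (kappa * tau) `^ s^-1.
  rewrite -(ler_pM2l (mulr_gt0 beta0 (powR_gt0 th a0))).
  have -> : beta * a `^ th * a `^ s^-1 = beta * a.
    by rewrite -mulrA -powRD ?(gt_eqF a0) ?implybT// subrK powRr1// ltW.
  apply: (le_trans aC); rewrite le_eqVlt; apply/orP; left; apply/eqP.
  by rewrite /C3; field; rewrite gt_eqF// subr_gt0.
move=> /(ge0_ler_powR (ltW s0)); rewrite !nnegrE => /(_ (powR_ge0 _ _)).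
rewrite mulr_ge0 ?powR_ge0 ?(ltW C30)// => /(_ isT).
have a_ge0 := ltW a0; have kt0 : 0 <= kappa * tau by rewrite mulr_ge0 ?ltW.
rewrite powRM ?powR_ge0 ?(ltW C30)// -!powRrM mulVf ?gt_eqF// !powRr1//.
move=> /le_trans; apply; rewrite mulrA.
have Ck : C3 `^ s * kappa <= 2^-1.
  rewrite ler_pdivrMr// mulrDr [X in _ <= _ + X]mulrA mulVf ?pnatr_eq0// mul1r lerDr.
  by rewrite !mulr_ge0// ltW.
by have := ler_wpM2r (ltW tau0) Ck; lra.
Qed.

(** * Rearrangements and Lorentz quasi-norms *)

Lemma ge0_le_poweR (R : realType) (r : R) (x y : \bar R) :
  0 <= r -> (0 <= x -> x <= y -> x `^ r <= y `^ r)%E.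
Proof.
move=> r0 x0 xy; apply: gt0_ler_poweR => //; rewrite in_itv/= leey andbT//.
exact: le_trans xy.
Qed.

Section rearrangement.
Context {R : realType} {n : nat}.
Local Notation mu := (@leb R n).
Local Open Scope ereal_scope.
Implicit Types (g h : Rn R n -> \bar R) (A B : set (Rn R n)).

(* No measurability is needed, [leb] being an outer measure. *)
Lemma leb_le A B : A `<=` B -> mu A <= mu B.
Proof. by move=> AB; exact: (le_mu_ext (borel_leb n) AB). Qed.

(** Lets almost everywhere comparisons of functions pass to their distribution functions; it rests
    on the subadditivity of the outer measure. *)
Lemma leb_le_negligible A B N : mu.-negligible N -> A `<=` B `|` N -> mu A <= mu B.
Proof.
move=> [N' [mN' N'0 NN']] /leb_le/le_trans; apply.
apply: le_trans (outer_measureU2 (mu_ext (borel_leb n)) B N) _.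
rewrite -[leRHS]adde0 leeD//; apply: (le_trans (leb_le NN')).
by rewrite -N'0.
Qed.

Lemma distribution_le g (a a' : R) : (a <= a')%R ->
  distribution_function g a' <= distribution_function g a.
Proof.
by move=> aa'; apply: leb_le => x /=; apply: le_lt_trans; rewrite lee_fin.
Qed.

Lemma rearrangement_ge0 g t : 0 <= rearrangement g t.
Proof.
by apply: le_ereal_inf_tmp => _ [a [a0 _] <-]; rewrite lee_fin ltW.
Qed.

Lemma rearrangement_le g (a t : R) : (0 < a)%R ->
  distribution_function g a <= t%:E -> rearrangement g t <= a%:E.
Proof. by move=> a0 ga; apply: ereal_inf_lbound; exists a. Qed.

Lemma rearrangement_lt g (a t : R) : rearrangement g t < a%:E ->
  distribution_function g a <= t%:E.
Proof.
move=> /ereal_inf_lt[_ [b [b0 gb] <-]]; rewrite lte_fin => ba.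
by apply: le_trans gb; apply: distribution_le; exact: ltW.
Qed.

Lemma rearrangement_mono g h t :
  (forall a : R, (0 < a)%R -> distribution_function g a <= distribution_function h a) ->
  rearrangement g t <= rearrangement h t.
Proof.
move=> gh; apply: ereal_inf_le_tmp => _ [a [a0 ha] <-]; exists a => //.
by split => //; apply: le_trans ha; exact: gh.
Qed.

Lemma distribution_ae_le g h : {ae mu, forall x, `|g x| <= `|h x|} ->
  forall a : R, distribution_function g a <= distribution_function h a.
Proof.
move=> gh a; apply: leb_le_negligible gh _ => x /= ax.
have [hx|/negP] := boolP (`|g x| <= `|h x|); last by right.
by left => /=; apply: lt_le_trans hx.
Qed.

Lemma rearrangement_nonincreasing g (t t' : R) : (t <= t')%R ->
  rearrangement g t' <= rearrangement g t.
Proof.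
move=> tt'; apply: ereal_inf_le_tmp => _ [a [a0 ha] <-]; exists a => //.
by split => //; apply: (le_trans ha); rewrite lee_fin.
Qed.

(** Superlevel sets of a nonincreasing function are intervals. *)
Lemma measurable_rearrangement g (D : set R) : measurable D ->
  measurable_fun D (rearrangement g).
Proof.
move=> mD; apply: measurable_funTS.
apply: (measurability _ (ErealGenCInfty.measurableE R)).
move=> _ [_ [a ->] <-]; rewrite setTI.
apply: is_interval_measurable => s t /=; rewrite !in_itv/= !andbT.
move=> fs ft u /andP[su ut]; rewrite in_itv/= andbT; apply: (le_trans ft).
exact: rearrangement_nonincreasing.
Qed.

End rearrangement.

Definition lorentz_integrand (R : realType) n (p r : R) (g : Rn R n -> \bar R)
  (t : R) : \bar R := (((t `^ p^-1)%:E * rearrangement g t) `^ r * (t^-1)%:E)%E.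

Section lorentz_integrand.
Context {R : realType} {n : nat} (p r : R).
Hypotheses (p0 : 0 < p) (r0 : 0 < r).
Local Open Scope ereal_scope.
Implicit Types (g h : Rn R n -> \bar R).

Lemma lorentz_normE g : lorentz_norm p r%:E g =
  (\int[lebesgue_measure]_(t in `]0%R, +oo[) lorentz_integrand p r g t) `^ r^-1.
Proof. by []. Qed.

Lemma lorentz_integrand_ge0 g (t : R) : (0 < t)%R -> 0 <= lorentz_integrand p r g t.
Proof.
by move=> t0; rewrite mule_ge0 ?poweR_ge0// lee_fin invr_ge0 ltW.
Qed.

Lemma measurable_lorentz_integrand g :
  measurable_fun (`]0%R, +oo[ : set R) (lorentz_integrand p r g).
Proof.
apply: emeasurable_funM.
  apply: (measurableT_comp (measurable_poweR r)).
  apply: emeasurable_funM; last exact: measurable_rearrangement.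
  by apply/measurable_EFinP; apply: measurable_funTS; exact: measurable_powR.
apply/measurable_EFinP; apply: open_continuous_measurable_fun.
  exact: interval_open.
move=> x; rewrite inE/= in_itv/= andbT => x0.
by apply: continuousV; rewrite ?gt_eqF.
Qed.

Lemma lorentz_integrand_le g h (t : R) : (0 < t)%R ->
  rearrangement g t <= rearrangement h t ->
  lorentz_integrand p r g t <= lorentz_integrand p r h t.
Proof.
move=> t0 gh; apply: lee_wpmul2r; first by rewrite lee_fin invr_ge0 ltW.
apply: ge0_le_poweR; first exact: ltW.
  by rewrite mule_ge0 ?rearrangement_ge0// lee_fin powR_ge0.
by apply: lee_wpmul2l => //; rewrite lee_fin powR_ge0.
Qed.

End lorentz_integrand.

Lemma lorentz_norm_ge0 (R : realType) n (p : R) (r : \bar R)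
  (g : Rn R n -> \bar R) : (0 <= lorentz_norm p r g)%E.
Proof.
case: r => [r| |] //=; first exact: poweR_ge0.
apply: le_ereal_sup_tmp; exists ((1 `^ p^-1)%:E * rearrangement g 1)%E.
  by exists 1 => //; exact: ltr01.
by rewrite mule_ge0 ?rearrangement_ge0// lee_fin powR_ge0.
Qed.

Lemma lorentz_norm_le (R : realType) n (p : R) (r : \bar R)
    (g h : Rn R n -> \bar R) : 0 < p -> (0 < r)%E ->
  (forall t, 0 < t -> (rearrangement g t <= rearrangement h t)%E) ->
  (lorentz_norm p r g <= lorentz_norm p r h)%E.
Proof.
move=> p0; case: r => [r| |] r0 gh; last by rewrite ltNge leNye in r0.
  rewrite lte_fin in r0; rewrite !lorentz_normE.
  apply: ge0_le_poweR; first by rewrite invr_ge0 ltW.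
    by apply: integral_ge0 => t; rewrite /= in_itv/= andbT; exact: lorentz_integrand_ge0.
  apply: ge0_le_integral => //.
  - by move=> t; rewrite /= in_itv/= andbT; exact: lorentz_integrand_ge0.
  - exact: measurable_lorentz_integrand.
  - exact: measurable_lorentz_integrand.
  - move=> t; rewrite /= in_itv/= andbT => t0.
    by apply: lorentz_integrand_le => //; exact: gh.
apply: ge_ereal_sup => _ [t t0 <-].
apply: (@le_trans _ _ ((t `^ p^-1)%:E * rearrangement h t)%E).
  by apply: lee_wpmul2l; rewrite ?lee_fin ?powR_ge0//; exact: gh.
by apply: ereal_sup_ubound; exists t.
Qed.

(** The right-hand side is a measure in [A] that agrees with the Lebesgue measure on the intervals
    []a, b]], so the uniqueness of the latter applies. *)
Lemma lebesgue_measure_scale (R : realType) (c : R) (A : set R) :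
  0 < c -> measurable A ->
  (lebesgue_measure A =
   c%:E * lebesgue_measure ((fun t : R => (c * t)%R) @^-1` A))%E.
Proof.
move=> c0 mA.
have mc : measurable_fun [set: measurableTypeR R]
    (fun t : R => c * t : measurableTypeR R).
  exact: measurable_funM.
pose k : {nonneg R} := NngNum (ltW c0).
pose m := mscale k
  (measure_function_pushforward__canonical__measure_function_Measure
    (@lebesgue_measure R) mc).
rewrite (@lebesgue_measure_unique R m)// => _ [[a b] _ <-] /=.
rewrite /m /mscale /= /pushforward.
rewrite (_ : _ @^-1` _ = `](a / c), (b / c)]%classic); last first.
  apply/seteqP; split => t /=; rewrite !in_itv/= ltr_pdivrMr// ler_pdivlMr//;
  by rewrite mulrC.
rewrite !lebesgue_measure_itv/= !lte_fin ltr_pM2r ?invr_gt0//.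
case: ifPn => _; last by rewrite mule0.
by rewrite -!EFinD -EFinM; congr EFin; field; rewrite gt_eqF.
Qed.

(** Change of variables along the push-forward by the dilation. For Lorentz integrands the factor
    [c^-1] will cancel a factor [c] that comes from the weight [t^-1]. *)
Lemma ge0_integral_scale (R : realType) (c : R) (f : R -> \bar R) : 0 < c ->
  measurable_fun (`]0, +oo[ : set R) f -> (forall t, 0 < t -> (0 <= f t)%E) ->
  (\int[lebesgue_measure]_(t in `]0%R, +oo[) f (c * t)%R =
   (c^-1)%:E * \int[lebesgue_measure]_(t in `]0%R, +oo[) f t)%E.
Proof.
move=> c0 mf f0; pose k : {nonneg R} := NngNum (ltW c0).
have mc : measurable_fun [set: measurableTypeR R]
    (fun t : R => c * t : measurableTypeR R).
  exact: measurable_funM.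
pose pm := measure_function_pushforward__canonical__measure_function_Measure
    (@lebesgue_measure R) mc.
pose m := mscale k pm.
have f0' t : (`]0, +oo[%classic : set R) t -> (0 <= f t)%E.
  by rewrite /= in_itv/= andbT; exact: f0.
have -> : (\int[lebesgue_measure]_(t in `]0%R, +oo[) f t =
    \int[m]_(t in `]0%R, +oo[) f t)%E.
  by apply: eq_measure_integral => A mA _; exact: (lebesgue_measure_scale c0 mA).
rewrite ge0_integral_mscale//= muleA -EFinM mulVf ?gt_eqF// mul1e.
rewrite ge0_integral_pushforward//; last by move=> t /[!inE]; exact: f0'.
congr integral; apply/seteqP; split => t /=; rewrite !in_itv/= !andbT.
  by move=> t0; rewrite mulr_gt0.
by rewrite pmulr_rgt0.
Qed.

Section dilation.
Context {R : realType} {n : nat} (p kappa rho sigma : R).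
Hypotheses (p0 : 0 < p) (kappa0 : 0 < kappa) (rho0 : 0 < rho) (sigma0 : 0 < sigma).
Hypothesis rho_sigma : rho `^ p < sigma.
Variables g h : Rn R n -> \bar R.
Hypothesis gh : forall gam t : R, 0 < gam -> 0 < t ->
  (forall i, (distribution_function h (gam / rho ^+ i) <= (kappa * sigma ^+ i * t)%:E)%E) ->
  (distribution_function g gam <= t%:E)%E.
Local Open Scope ereal_scope.

Let c i : R := (kappa * sigma ^+ i)%R.
(** Ratio of the geometric series below: passing from [i] to [i + 1] multiplies the value by [rho]
    and dilates the argument by [sigma], which contributes [sigma^(-1/p)] in L^(p,r). It is below 1
    by [rho_sigma]. *)
Let y : R := (rho * sigma `^ (- p^-1))%R.

Let c0 i : (0 < c i)%R. Proof. by rewrite mulr_gt0// exprn_gt0. Qed.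

Let y0 : (0 < y)%R. Proof. by rewrite mulr_gt0// powR_gt0. Qed.

Let y1 : (y < 1)%R.
Proof.
rewrite /y powRN ltr_pdivrMr ?powR_gt0// mul1r.
have pp : ((rho `^ p) `^ p^-1 = rho)%R by rewrite -powRrM mulfV ?gt_eqF// powRr1// ltW.
by rewrite -{1}pp; apply: gt0_ltr_powR; rewrite ?invr_gt0 ?nnegrE ?powR_ge0 ?(ltW sigma0).
Qed.

Let u (t : R) i := (rho ^+ i)%:E * rearrangement h (c i * t)%R.

Let u0 t i : 0 <= u t i.
Proof. by rewrite mule_ge0 ?rearrangement_ge0// lee_fin exprn_ge0// ltW. Qed.

(** A level [m + e] strictly above all [u t i] gives rearrangements of [h] strictly below
    [(m + e) / rho^i], hence bounds on its distribution function to which [gh] applies. For the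
    least [M] this reads [g*(t) <= sup_i rho^i h*(kappa sigma^i t)]. *)
Let rearrangement_le_sup (t : R) (M : \bar R) : (0 < t)%R ->
  (forall i, u t i <= M) -> rearrangement g t <= M.
Proof.
move=> t0; case: M => [m| |] uM; last 2 first.
- exact: leey.
- by have := le_trans (u0 t 0%N) (uM 0%N).
have m0 : (0 <= m)%R by rewrite -lee_fin (le_trans (u0 t 0%N) (uM 0%N)).
apply/lee_addgt0Pr => e e0; rewrite -EFinD.
have me0 : (0 < m + e)%R by rewrite ltr_wpDl.
apply: rearrangement_le => //; apply: gh => // i; apply: rearrangement_lt.
have r0 : (0 < rho ^+ i)%R by rewrite exprn_gt0.
rewrite [((_ + _) / _)%R]mulrC EFinM lte_pdivlMl//.
by apply: (le_lt_trans (uM i)); rewrite lte_fin ltrDl.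
Qed.

Let dilationE (t : R) i : (0 < t)%R ->
  (t `^ p^-1)%:E * u t i =
  (kappa `^ (- p^-1) * y ^+ i)%:E *
    (((c i * t) `^ p^-1)%:E * rearrangement h (c i * t)%R).
Proof.
move=> t0; rewrite /u !muleA -!EFinM; congr (_%:E * _).
rewrite /c -mulrA powRM ?(ltW kappa0) ?mulr_ge0 ?exprn_ge0 ?(ltW sigma0) ?(ltW t0)//.
rewrite powRM ?exprn_ge0 ?(ltW sigma0) ?(ltW t0)// !powRN /y exprMn powRN exprVn.
rewrite powR_exprn; last exact: ltW.
by field; rewrite expf_neq0 ?gt_eqF ?powR_gt0.
Qed.

Lemma lorentz_weak_dilation :
  lorentz_norm p +oo g <= (kappa `^ (- p^-1))%:E * lorentz_norm p +oo h.
Proof.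
apply: ge_ereal_sup => _ [t t0 <-].
have tp : (0 < t `^ p^-1)%R by rewrite powR_gt0.
rewrite muleC -lee_pdivlMr//; apply: rearrangement_le_sup => // i.
rewrite lee_pdivlMr// muleC dilationE// EFinM -muleA.
apply: lee_wpmul2l; first by rewrite lee_fin powR_ge0.
apply: (@le_trans _ _ (((c i * t) `^ p^-1)%:E * rearrangement h (c i * t)%R)).
  rewrite -[leRHS]mul1e; apply: lee_wpmul2r.
    by rewrite mule_ge0 ?rearrangement_ge0// lee_fin powR_ge0.
  by rewrite lee_fin exprn_ile1// ltW.
by apply: ereal_sup_ubound; exists (c i * t)%R => //=; rewrite mulr_gt0.
Qed.

(** The supremum over [i] is at most the l^r quasi-norm, so that [r]-th powers add up. The factor
    [c i] comes from rewriting the weight [t^-1] at the dilated point [c i * t]. *)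
Let integrand_dilation (r t : R) : (0 < r)%R -> (0 < t)%R ->
  lorentz_integrand p r g t <= \sum_(0 <= i <oo)
    (kappa `^ (- (r / p)) * (y `^ r) ^+ i * c i)%:E * lorentz_integrand p r h (c i * t)%R.
Proof.
move=> r0 t0; have t_ge0 := ltW t0.
pose S := \sum_(0 <= i <oo) (u t i) `^ r.
have gS : rearrangement g t <= S `^ r^-1.
  apply: rearrangement_le_sup => // i.
  have -> : u t i = ((u t i) `^ r) `^ r^-1 by rewrite -poweRrM mulfV ?gt_eqF// poweRe1.
  apply: ge0_le_poweR; rewrite ?invr_ge0 ?poweR_ge0 ?(ltW r0)//.
  by apply: (@nneseries_ge _ (fun i => u t i `^ r)) => j; exact: poweR_ge0.
have S0 : 0 <= S by apply: nneseries_ge0 => *; exact: poweR_ge0.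
apply: (@le_trans _ _ ((t `^ p^-1 `^ r / t)%:E * S)).
  rewrite /lorentz_integrand EFinM muleAC; apply: lee_wpmul2r.
    by rewrite lee_fin invr_ge0.
  rewrite poweRM ?rearrangement_ge0 ?lee_fin ?powR_ge0//.
  apply: lee_wpmul2l; first by rewrite poweR_ge0.
  have -> : S = (S `^ r^-1) `^ r by rewrite -poweRrM mulVf ?gt_eqF// poweRe1.
  by apply: ge0_le_poweR; rewrite ?rearrangement_ge0 ?(ltW r0).
rewrite -nneseriesZl; last by move=> *; exact: poweR_ge0.
rewrite le_eqVlt; apply/orP; left; apply/eqP; apply: eq_eseriesr => i _.
have := congr1 (fun z => z `^ r * (t^-1)%:E) (dilationE i t0).
rewrite poweRM ?lee_fin ?powR_ge0// poweR_EFin muleAC -EFinM => ->.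
rewrite poweRM; last 2 first.
- by rewrite lee_fin mulr_ge0 ?powR_ge0// exprn_ge0// ltW.
- by rewrite mule_ge0 ?rearrangement_ge0// lee_fin powR_ge0.
rewrite poweR_EFin powRM ?powR_ge0 ?exprn_ge0 ?(ltW y0)//.
rewrite -powRrM mulNr [(p^-1 * r)%R]mulrC.
rewrite powR_exprn; last exact: ltW.
rewrite /lorentz_integrand [in RHS]EFinM -!muleA; congr (_ * _).
rewrite [in RHS]muleC -muleA; congr (_ * _); rewrite -EFinM; congr EFin.
by field; rewrite !gt_eqF ?c0.
Qed.

Lemma lorentz_strong_dilation (r : R) : (0 < r)%R ->
  lorentz_norm p r%:E g <=
  ((kappa `^ (- (r / p)) / (1 - y `^ r)) `^ r^-1)%:E * lorentz_norm p r%:E h.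
Proof.
move=> r0; rewrite !lorentz_normE.
have yr : (0 <= y `^ r < 1)%R.
  rewrite powR_ge0/=; have : (y `^ r < 1 `^ r)%R.
    by apply: gt0_ltr_powR; rewrite ?nnegrE ?(ltW y0).
  by rewrite powR1.
set I : \bar R := \int[lebesgue_measure]_(t in `]0%R, +oo[) lorentz_integrand p r h t.
have I0 : 0 <= I.
  by apply: integral_ge0 => t; rewrite /= in_itv/= andbT; exact: lorentz_integrand_ge0.
have B0 : (0 < kappa `^ (- (r / p)) / (1 - y `^ r))%R.
  by rewrite divr_gt0 ?powR_gt0// subr_gt0; case/andP: yr.
rewrite -poweR_EFin -poweRM//; last by rewrite lee_fin ltW.
apply: ge0_le_poweR; first by rewrite invr_ge0 ltW.
  by apply: integral_ge0 => t; rewrite /= in_itv/= andbT; exact: lorentz_integrand_ge0.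
(* An infinite integral makes the bound trivial, the constant being positive; otherwise the dilated
   integrals are real and form a geometric series. *)
have [Ioo|Ioo] := ltP I +oo; last first.
  by move: Ioo; rewrite leye_eq => /eqP ->; rewrite gt0_muley ?leey// lte_fin.
have If : I = (fine I)%:E by rewrite fineK// ge0_fin_numE.
pose f i t := (kappa `^ (- (r / p)) * (y `^ r) ^+ i * c i)%:E *
  lorentz_integrand p r h (c i * t)%R.
have k_ge0 i : 0 <= (kappa `^ (- (r / p)) * (y `^ r) ^+ i * c i)%:E.
  by rewrite lee_fin !mulr_ge0 ?powR_ge0 ?exprn_ge0 ?powR_ge0// ltW.
have f0 i t : (0 < t)%R -> 0 <= f i t.
  move=> t0; rewrite mule_ge0// lorentz_integrand_ge0// mulr_gt0//.
have ml i : measurable_fun (`]0%R, +oo[ : set R)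
    (fun t => lorentz_integrand p r h (c i * t)%R).
  apply: (measurable_comp (F := (`]0%R, +oo[ : set R))) => //.
  - move=> _ [t + <-]; rewrite /= !in_itv/= !andbT => t0.
    by rewrite mulr_gt0.
  - exact: measurable_lorentz_integrand.
have mf i : measurable_fun (`]0%R, +oo[ : set R) (f i).
  by apply: measurable_funeM; exact: ml.
apply: (@le_trans _ _ (\int[lebesgue_measure]_(t in `]0%R, +oo[)
    \sum_(0 <= i <oo) f i t)).
  apply: ge0_le_integral => //.
  - by move=> t; rewrite /= in_itv/= andbT; exact: lorentz_integrand_ge0.
  - exact: measurable_lorentz_integrand.
  - apply: measurable_nneseries => // i t.
    by rewrite /= in_itv/= andbT; exact: f0.
  - by move=> t; rewrite /= in_itv/= andbT => t0; exact: integrand_dilation.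
rewrite integral_nneseries//; last first.
  by move=> i t; rewrite /= in_itv/= andbT; exact: f0.
rewrite (eq_eseriesr (g := fun i =>
    (kappa `^ (- (r / p)) * fine I * (y `^ r) ^+ i)%:E)); last first.
  move=> i _; rewrite ge0_integralZl//; last 2 first.
  - exact: ml.
  - move=> t; rewrite /= in_itv/= andbT => t0.
    by rewrite lorentz_integrand_ge0// mulr_gt0.
  transitivity ((kappa `^ (- (r / p)) * (y `^ r) ^+ i * c i)%:E * ((c i)^-1%:E * I)).
    congr (_ * _); apply: ge0_integral_scale => //.
      exact: measurable_lorentz_integrand.
    by move=> t; exact: lorentz_integrand_ge0.
  by rewrite If -!EFinM; congr EFin; field; rewrite gt_eqF.
rewrite nneseries_geometric// If -EFinM lee_fin le_eqVlt.
by apply/orP; left; apply/eqP; rewrite mulrAC.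
Qed.

End dilation.

Lemma lorentz_norm_dilation (R : realType) (p : R) (r : \bar R)
    (kappa rho sigma : R) :
  0 < p -> (0 < r)%E -> 0 < kappa -> 0 < rho -> 0 < sigma -> rho `^ p < sigma ->
  exists2 C : R, 0 < C & forall n (g h : Rn R n -> \bar R),
  (forall gam t : R, 0 < gam -> 0 < t ->
    (forall i, (distribution_function h (gam / rho ^+ i) <= (kappa * sigma ^+ i * t)%:E)%E) ->
    (distribution_function g gam <= t%:E)%E) ->
  (lorentz_norm p r g <= C%:E * lorentz_norm p r h)%E.
Proof.
move=> p0 + kappa0 rho0 sigma0 rs.
case: r => [r| |] r0; last by rewrite ltNge leNye in r0.
  pose C := (kappa `^ (- (r / p)) / (1 - (rho * sigma `^ (- p^-1)) `^ r)) `^ r^-1.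
  (* Adding 1 makes the constant positive at once. *)
  exists (C + 1); first by rewrite ltr_wpDl// powR_ge0.
  move=> n g h gh; rewrite lte_fin in r0.
  apply: le_trans (lorentz_strong_dilation p0 kappa0 rho0 sigma0 rs gh r0) _.
  by apply: lee_wpmul2r; [exact: lorentz_norm_ge0|rewrite lee_fin lerDl].
exists (kappa `^ (- p^-1)); first exact: powR_gt0.
by move=> n g h gh; apply: (lorentz_weak_dilation p0 kappa0 rho0 sigma0 rs) => //.
Qed.

(** * Functions of finite Lorentz quasi-norm and convergence to zero *)

Lemma ereal_cvg0P (R : realType) (u : nat -> \bar R) : (forall k, 0 <= u k)%E ->
  (u k @[k --> \oo] --> 0%E) <->
  (forall e : R, 0 < e -> \forall k \near \oo, (u k <= e%:E)%E).
Proof.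
move=> u0; split.
  move=> /fine_cvgP[ufin /cvgrPdist_le cu] e e0; near=> k.
  have uk : u k \is a fin_num by near: k.
  rewrite -(fineK uk) lee_fin -[leLHS]ger0_norm ?fine_ge0// -normrN -sub0r.
  by near: k; exact: cu.
move=> eu; apply/fine_cvgP; split.
  have := eu 1 ltr01; apply: filterS => k uk.
  by rewrite ge0_fin_numE// (le_lt_trans uk) ?ltry.
apply/cvgrPdist_le => e e0; have := eu e e0; apply: filterS => k uk /=.
rewrite sub0r normrN ger0_norm ?fine_ge0// -lee_fin fineK//.
by rewrite ge0_fin_numE// (le_lt_trans uk) ?ltry.
Unshelve. all: by end_near. Qed.

Section lorentz_finite.
Context {R : realType} {n : nat} (p : R) (r : \bar R) (h : Rn R n -> \bar R).
Hypotheses (p0 : 0 < p) (r0 : (0 < r)%E) (hfin : (lorentz_norm p r h < +oo)%E).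
Local Open Scope ereal_scope.

(** This is the inclusion of L^(p,r) in L^(p,oo). For finite [r] the integrand on []t/2, t]] is at
    least a constant, because there [s^(1/p) >= (t/2)^(1/p)], [h*(s) >= h*(t)] and [1/s >= 1/t]; the
    interval has length [t/2]. *)
Lemma lorentz_weak_bound : exists B : R, forall t : R, (0 < t)%R ->
  (t `^ p^-1)%:E * rearrangement h t <= B%:E.
Proof.
case: r r0 hfin => [q| |] q0 hq; last by rewrite ltNge leNye in q0.
  rewrite lorentz_normE in hq; rewrite lte_fin in q0.
  have qi : (q^-1 != 0)%R by rewrite invr_eq0 gt_eqF.
  have {hq} := lty_poweRy qi hq.
  set I : \bar R := \int[lebesgue_measure]_(t in `]0%R, +oo[) lorentz_integrand p q h t.
  move=> Ioo.
  have I0 : 0 <= I.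
    by apply: integral_ge0 => t; rewrite /= in_itv/= andbT; exact: lorentz_integrand_ge0.
  have If : I = (fine I)%:E by rewrite fineK// ge0_fin_numE.
  exists (2 `^ p^-1 * (2 * fine I) `^ q^-1)%R => t t0.
  have t20 : (0 < t / 2)%R by rewrite divr_gt0.
  pose v := ((t / 2) `^ p^-1)%:E * rearrangement h t.
  have v0 : 0 <= v by rewrite mule_ge0 ?rearrangement_ge0// lee_fin powR_ge0.
  have vI : v `^ q <= (2 * fine I)%:E.
    have : v `^ q * (t^-1)%:E * (t / 2)%:E <= I.
      apply: (@le_trans _ _ (\int[lebesgue_measure]_(s in `](t / 2)%R, t]) (v `^ q * (t^-1)%:E))).
        rewrite integral_cst//= lebesgue_measure_itv/= lte_fin.
        rewrite ltr_pdivrMr// ltr_pMr// ltr1n/= -EFinB.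
        by rewrite (_ : t - t / 2 = t / 2)%R//; field.
      have tD : (`](t / 2)%R, t] : set R) `<=` `]0%R, +oo[.
        move=> s /=; rewrite !in_itv/= andbT => /andP[+ _].
        exact: lt_trans.
      apply: (@le_trans _ _ (\int[lebesgue_measure]_(s in `](t / 2)%R, t])
          lorentz_integrand p q h s)).
        apply: ge0_le_integral => //.
        - by move=> s _; rewrite mule_ge0 ?poweR_ge0// lee_fin invr_ge0 ltW.
        - by apply: measurable_funS tD _ => //; exact: measurable_lorentz_integrand.
        - move=> s; rewrite /= in_itv/= => /andP[ts st].
          have s0 : (0 < s)%R by exact: lt_trans ts.
          apply: lee_pmul; first exact: poweR_ge0.
          + by rewrite lee_fin invr_ge0 ltW.
          + apply: ge0_le_poweR; [exact: ltW|exact: v0|].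
            apply: lee_pmul; [by rewrite lee_fin powR_ge0|exact: rearrangement_ge0| |].
              rewrite lee_fin; apply: ge0_ler_powR; rewrite ?invr_ge0 ?nnegrE ?(ltW p0)//.
              * exact: ltW.
              * exact: ltW.
              * exact: ltW.
            exact: rearrangement_nonincreasing.
          + by rewrite lee_fin lef_pV2.
      apply: ge0_subset_integral => //.
        exact: measurable_lorentz_integrand.
      by move=> s; rewrite /= in_itv/= andbT; exact: lorentz_integrand_ge0.
    rewrite If -muleA -EFinM (_ : t^-1 * (t / 2) = 2^-1)%R; last by field; rewrite gt_eqF.
    by rewrite muleC -lee_pdivlMl ?invr_gt0// invrK -EFinM.
  have vB : v <= ((2 * fine I) `^ q^-1)%:E.
    have -> : v = (v `^ q) `^ q^-1 by rewrite -poweRrM mulfV ?gt_eqF// poweRe1.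
    rewrite -poweR_EFin; apply: ge0_le_poweR => //; last exact: poweR_ge0.
    by rewrite invr_ge0 ltW.
  have -> : (t `^ p^-1)%:E * rearrangement h t = (2 `^ p^-1)%:E * v.
    rewrite /v muleA -EFinM -powRM//; last exact: ltW.
    by congr ((_ `^ _)%:E * _); field.
  by rewrite EFinM; apply: lee_wpmul2l => //; rewrite lee_fin powR_ge0.
exists (fine (lorentz_norm p +oo h)) => t t0.
rewrite fineK; last by rewrite ge0_fin_numE// lorentz_norm_ge0.
by apply: ereal_sup_ubound; exists t.
Qed.

(** Superlevel sets of finite measure are what continuity from above requires in
    [distribution_cvg0]. *)
Lemma lorentz_distribution_lty (a : R) : (0 < a)%R ->
  exists t : R, (0 < t)%R /\ distribution_function h a <= t%:E.
Proof.
move=> a0; have [B hB] := lorentz_weak_bound.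
have B1 : (0 < `|B| + 1)%R by rewrite ltr_wpDl.
(* Large enough for [|B| t^(-1/p) < a]; the summand 1 makes [t] positive and the inequality
   strict. *)
pose t := (((`|B| + 1) / a) `^ p)%R.
have t0 : (0 < t)%R by rewrite powR_gt0// divr_gt0.
exists t; split => //; apply: rearrangement_lt.
have tp : (t `^ p^-1 = (`|B| + 1) / a)%R.
  by rewrite /t -powRrM mulfV ?gt_eqF// powRr1// divr_ge0// ltW.
have := hB t t0; rewrite tp muleC -lee_pdivlMr ?divr_gt0// => /le_lt_trans; apply.
rewrite -EFinM lte_fin invf_div mulrA ltr_pdivrMr// [ltRHS]mulrC ltr_pM2r//.
by rewrite (le_lt_trans (ler_norm B))// ltrDl.
Qed.

(** For every [e > 0], the set where [|h|] is infinite lies in the superlevel set at height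
    [h*(e) + 1], of measure at most [e]. *)
Lemma lorentz_ae_fin : measurable_fun [set: Rn R n] h ->
  {ae @leb R n, forall x, `|h x| < +oo}.
Proof.
move=> mh; exists [set x | `|h x| = +oo]; split; last 2 first.
- apply/eqP; rewrite eq_le measure_ge0 andbT; apply/lee_addgt0Pr => e e0.
  rewrite add0e; have [B hB] := lorentz_weak_bound.
  have hf : rearrangement h e < +oo.
    have := hB e e0; rewrite muleC -lee_pdivlMr ?powR_gt0// => /le_lt_trans; apply.
    by rewrite -EFinM ltry.
  have hff : rearrangement h e = (fine (rearrangement h e))%:E.
    by rewrite fineK// ge0_fin_numE// rearrangement_ge0.
  have := @rearrangement_lt _ _ h (fine (rearrangement h e) + 1)%R e.
  rewrite EFinD -hff lteDl ?lte_fin; last by rewrite hff.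
  move=> /(_ ltr01).
  apply: le_trans; apply: leb_le => x /= ->; exact: ltry.
- by move=> x /= /negP; rewrite -leNgt leye_eq => /eqP.
- rewrite -[X in measurable X]setTI (_ : [set x | _] = (fun x => `|h x|) @^-1` [set +oo])//.
  by apply: (measurableT_comp _ mh) => //; exact: emeasurable_set1.
Qed.

End lorentz_finite.

Section lorentz_cvg0.
Context {R : realType} {n : nat} (p r : R) (h : nat -> Rn R n -> \bar R).
Hypotheses (p0 : 0 < p) (r0 : 0 < r).
Hypothesis h0 : forall k x, (0 <= h k x)%E.
Hypothesis mh : forall k, measurable_fun [set: Rn R n] (h k).
Hypothesis hS : forall k x, (h k.+1 x <= h k x)%E.
Hypothesis hfin : (lorentz_norm p r%:E (h 0%N) < +oo)%E.
Hypothesis hcvg : {ae @leb R n, forall x, h k x @[k --> \oo] --> 0%E}.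
Local Open Scope ereal_scope.

Let h_mono i j x : (i <= j)%N -> h j x <= h i x.
Proof.
move=> ij; have /nonincreasing_seqP := fun k => hS k x.
by move=> /(_ i j ij).
Qed.

(** Continuity from above for decreasing superlevel sets: that of [h 0] has finite measure, and
    their intersection is null because [h k] tends to 0 almost everywhere. *)
Let distribution_cvg0 (a : R) : (0 < a)%R ->
  distribution_function (h k) a @[k --> \oo] --> 0.
Proof.
move=> a0; pose F k := [set x | a%:E < h k x].
have FE k : distribution_function (h k) a = leb (F k).
  by congr leb; apply/seteqP; split => x /=; rewrite gee0_abs.
have mF k : measurable (F k) by exact: measurable_esuperlevel.
have mI : measurable (\bigcap_k F k) by exact: bigcap_measurable.
have I0 : leb (\bigcap_k F k) = 0.
  apply/eqP; rewrite eq_le measure_ge0 andbT.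
  rewrite -(@measure0 _ _ _ (@leb R n)).
  apply: (leb_le_negligible hcvg) => x Fx; right => /= hx.
  have ax k : a%:E <= h k x by rewrite ltW//; exact: (Fx k I).
  have a20 : (0 < a / 2)%R by rewrite divr_gt0.
  have [N _ /(_ N (leqnn N)) hN] := (ereal_cvg0P (fun k => h0 k x)).1 hx _ a20.
  have := le_trans (ax N) hN; rewrite lee_fin leNgt ltr_pdivrMr// ltr_pMr//.
  by rewrite ltr1n.
rewrite -I0 (_ : (fun k => _) = @leb R n \o F); last by apply/funext => k; rewrite FE.
apply: nonincreasing_cvg_mu => //.
- have r0' : 0 < r%:E by rewrite lte_fin.
  have [t [t0 ht]] := lorentz_distribution_lty p0 r0' hfin a0.
  by rewrite FE in ht; exact: le_lt_trans ht (ltry _).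
- move=> i j ij; apply/subsetPset => x /= /lt_le_trans; apply.
  exact: h_mono.
Qed.

Let rearrangement_cvg0 (t a : R) : (0 < t)%R -> (0 < a)%R ->
  \forall k \near \oo, rearrangement (h k) t <= a%:E.
Proof.
move=> t0 a0; have D0 k : 0 <= distribution_function (h k) a by exact: measure_ge0.
have := (ereal_cvg0P D0).1 (distribution_cvg0 a0) t t0.
by apply: filterS => k; exact: rearrangement_le.
Qed.

Let integrand_cvg0 (t : R) : (0 < t)%R ->
  lorentz_integrand p r (h k) t @[k --> \oo] --> 0.
Proof.
move=> t0; apply/ereal_cvg0P => [k|e e0]; first exact: lorentz_integrand_ge0.
(* The solution of [(t^(1/p) a)^r / t = e]. *)
pose a := ((e * t) `^ r^-1 / t `^ p^-1)%R.
have a0 : (0 < a)%R by rewrite divr_gt0 ?powR_gt0 ?mulr_gt0.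
have := rearrangement_cvg0 t0 a0; apply: filterS => k hk.
rewrite /lorentz_integrand lee_pdivrMr//; apply: (@le_trans _ _ (((e * t) `^ r^-1)%:E `^ r)).
  apply: ge0_le_poweR; first exact: ltW.
    by rewrite mule_ge0 ?rearrangement_ge0// lee_fin powR_ge0.
  by rewrite muleC -lee_pdivlMr ?powR_gt0// -EFinM.
rewrite poweR_EFin -powRrM mulVf ?gt_eqF// powRr1; first by rewrite EFinM.
by apply: mulr_ge0; exact: ltW.
Qed.

(** Dominated convergence in [t], with the integrand of [h 0] as the bound: the distribution
    functions, hence the rearrangements and the integrands, tend to 0 pointwise. *)
Lemma lorentz_norm_cvg0 : lorentz_norm p r%:E (h k) @[k --> \oo] --> 0.
Proof.
pose D : set R := `]0%R, +oo[%classic.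
pose I k := \int[lebesgue_measure]_(t in D) lorentz_integrand p r (h k) t.
have I0 k : 0 <= I k.
  by apply: integral_ge0 => t; rewrite /D/= in_itv/= andbT; exact: lorentz_integrand_ge0.
have mI k : measurable_fun D (lorentz_integrand p r (h k)).
  exact: measurable_lorentz_integrand.
have ri : (r^-1 != 0)%R by rewrite invr_eq0 gt_eqF.
have I0fin : I 0%N < +oo by exact: lty_poweRy hfin.
have int0 : (@lebesgue_measure R).-integrable D (lorentz_integrand p r (h 0%N)).
  apply/integrableP; split; first exact: mI.
  apply: le_lt_trans I0fin; rewrite le_eqVlt; apply/orP; left; apply/eqP.
  apply: eq_integral => t; rewrite inE /D/= ?in_itv/= ?andbT => t0.
  by rewrite gee0_abs// lorentz_integrand_ge0.
have Icvg : I k @[k --> \oo] --> 0.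
  have := @dominated_convergence _ _ _ (@lebesgue_measure R) D (measurable_itv _)
    (fun k => lorentz_integrand p r (h k)) (cst 0) (lorentz_integrand p r (h 0%N)) mI
    (measurable_cst _).
  rewrite integral0 => /(_ _ int0 _)[].
  - apply: aeW => t; rewrite /D/= in_itv/= andbT; exact: integrand_cvg0.
  - apply: aeW => t k; rewrite /D/= in_itv/= andbT => t0.
    rewrite gee0_abs ?lorentz_integrand_ge0//.
    apply: lorentz_integrand_le => //; apply: rearrangement_mono => a a0.
    by apply: leb_le => x /= /lt_le_trans; apply; rewrite !gee0_abs// h_mono.
  - by [].
apply/ereal_cvg0P => [k|e e0]; first exact: lorentz_norm_ge0.
have := (ereal_cvg0P I0).1 Icvg _ (powR_gt0 r e0); apply: filterS => k Ik.
rewrite lorentz_normE; apply: (@le_trans _ _ ((e `^ r)%:E `^ r^-1)).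
  by apply: ge0_le_poweR; rewrite ?invr_ge0 ?(ltW r0)//; exact: I0.
by rewrite poweR_EFin -powRrM mulfV ?gt_eqF// powRr1// ltW.
Qed.

End lorentz_cvg0.

(** * The size of the atoms *)

Section hypotheses.
Context {R : realType} {n : nat}.
Local Notation mu := (@leb R n).
Implicit Types (f : Rn R n -> R[i]) (Q : set (Rn R n)).

Lemma normc_ge0 (z : R[i]) : 0 <= Normc.normc z.
Proof. by case: z => x y; exact: sqrtr_ge0. Qed.

Lemma measurable_normc f : L0 f ->
  measurable_fun [set: Rn R n] (fun x => Normc.normc (f x)).
Proof.
move=> [mre mim].
rewrite (_ : (fun x => _) = (fun x => Num.sqrt (complex.Re (f x) ^+ 2 + complex.Im (f x) ^+ 2))).
  apply: (measurableT_comp (f := @Num.sqrt R)).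
    by apply: continuous_measurable_fun; exact: sqrt_continuous.
  by apply: measurable_funD; exact: measurable_funX.
by apply/funext => x; case: (f x).
Qed.

(** A Lindelof argument: each point off the support lies in a cube with rational centre and
    half-edge on which [f] vanishes almost everywhere, and there are countably many such cubes. *)
Lemma supp_ae f Q : supp f `<=` Q -> {ae mu, forall x, ~ Q x -> f x = 0}.
Proof.
move=> fQ.
pose B (k : {ffun 'I_n -> rat} * rat) : set (Rn R n) :=
  [set y | forall i, `|Defs.coord y i - ratr (k.1 i)| < ratr k.2].
(* With the condition on [B k] made part of it, [N k] is negligible in all cases: it is empty when
   [f] does not vanish almost everywhere on [B k]. *)
pose N k := [set y | {ae mu, forall z, B k z -> f z = 0} /\ B k y /\ f y <> 0].
have nN k : mu.-negligible (N k).
  have [aek|naek] := pselect {ae mu, forall z, B k z -> f z = 0}.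
    by apply: negligibleS aek => y [_ [By fy]] /= /(_ By).
  by rewrite (_ : N k = set0); [exact: negligible_set0|apply/seteqP; split => // y []].
pose N' j := if unpickle j is Some k then N k else set0.
have : mu.-negligible (\bigcup_j N' j).
  apply: negligible_bigcup => j; rewrite /N'.
  by case: unpickle => [k|]; [exact: nN|exact: negligible_set0].
apply: negligibleS => x /= /not_implyP[Qx fx].
have : ~ supp f x by move=> /fQ.
move=> /contrapT[e e0 fe].
(* As [d < e / 2], a cube of half-edge [d] that contains [x] stays within [e] of [x] in each
   coordinate. *)
have [d] : exists q : rat, ratr q \in `](0 : R), (e / 2)[.
  by apply: rat_in_itvoo; rewrite divr_gt0.
rewrite in_itv/= => /andP[d0 de].
have /choice[c cP] (i : 'I_n) : exists q : rat, `|Defs.coord x i - ratr q| < ratr d.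
  have [|q] := @rat_in_itvoo R (Defs.coord x i - ratr d) (Defs.coord x i + ratr d).
    by rewrite ltrD2l gt0_cp.
  rewrite in_itv/= => /andP[? ?]; exists q.
  by rewrite ltr_norml; apply/andP; split; lra.
pose k : {ffun 'I_n -> rat} * rat := ([ffun i => c i], d).
exists (pickle k) => //; rewrite /N' pickleK; split; last first.
  by split => // i; rewrite /= ffunE; exact: cP.
apply: filterS fe => y fy By; apply: fy => i.
have := By i; rewrite /= ffunE => yc; have xc := cP i.
rewrite -(subrKA (ratr (c i))); apply: (le_lt_trans (ler_normD _ _)).
by rewrite [X in _ + X]distrC; lra.
Qed.

(** Of the two suprema only the level [a] and the cube [Q] are kept. With [E] the superlevel set,
    this gives [a |Q|^(1/s - 1/t) |E n Q|^(1/t) <= |Q|^(1/s)], where the powers [1/s] cancel. *)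
Lemma weak_morrey_distribution (s t : R) f Q (w a : R) : 0 < t ->
  is_cube Q -> 0 < w -> mu Q = w%:E -> L0 f ->
  (weak_morrey_norm s t (modulus f) <= mu Q `^ s^-1)%E -> 0 < a ->
  (mu ([set x | (a < Normc.normc (f x))%R] `&` Q) <= (w * a `^ (- t))%:E)%E.
Proof.
move=> t0 cQ w0 muQ Lf; rewrite muQ => fQ a0.
pose E := [set x | (a%:E < `|modulus f x|)%E].
have EE : E = [set x | (a < Normc.normc (f x))%R].
  apply/seteqP; split => x; rewrite /E/= ger0_norm ?normc_ge0//.
have mQ := measurable_cube cQ.
have mE : measurable E.
  by rewrite EE; apply: measurable_superlevel; exact: measurable_normc.
have mEQ : measurable (E `&` Q) by exact: measurableI.
have tn0 : t != 0 by rewrite gt_eqF.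
have N1 : ('N[mu]_(t%:E)[(fun x => (\1_E x)%:E * (\1_Q x)%:E)] =
    mu (E `&` Q) `^ t^-1)%E.
  rewrite unlock; congr (_ `^ _)%E.
  rewrite -[in RHS](setIT (E `&` Q)) -integral_indic//.
  apply: eq_integral => x _; rewrite -EFinM !indicE in_setI.
  by case: (x \in E); case: (x \in Q);
    rewrite /= ?mulr1 ?mulr0 ?normr0 ?normr1 ?powR1 ?powR0.
have : (a%:E * (w%:E `^ (s^-1 - t^-1) * mu (E `&` Q) `^ t^-1) <= w%:E `^ s^-1)%E.
  apply: le_trans fQ; rewrite -N1 -muQ.
  apply: (@le_trans _ _ (a%:E * morrey_norm s t (fun x => (\1_E x)%:E))%E).
    apply: lee_wpmul2l; first by rewrite lee_fin ltW.
    by apply: ereal_sup_ubound; exists Q.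
  by apply: ereal_sup_ubound; exists a.
have EQw : (mu (E `&` Q) <= w%:E)%E.
  by rewrite -muQ; apply: leb_le; exact: subIsetr.
pose m := fine (mu (E `&` Q)).
have m0 : 0 <= m by exact: fine_ge0.
have mfin : mu (E `&` Q) = m%:E.
  by rewrite fineK// ge0_fin_numE// (le_lt_trans EQw) ?ltry.
rewrite -EE mfin.
rewrite !poweR_EFin -!EFinM !lee_fin.
rewrite powRB; last by rewrite (gt_eqF w0) implybT.
have ws : 0 < w `^ s^-1 by exact: powR_gt0.
have wt : 0 < w `^ t^-1 by exact: powR_gt0.
rewrite (_ : a * _ = w `^ s^-1 * (a * m `^ t^-1 / w `^ t^-1)); last by field; rewrite gt_eqF.
rewrite -[leRHS]mulr1 ler_pM2l// ler_pdivrMr// mul1r mulrC -ler_pdivlMr// => mw.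
have : (m `^ t^-1) `^ t <= (w `^ t^-1 / a) `^ t.
  by apply: ge0_ler_powR; rewrite ?nnegrE ?powR_ge0 ?(ltW t0)// divr_ge0 ?powR_ge0// ltW.
rewrite -powRrM mulVf// powRr1// powRM ?powR_ge0 ?invr_ge0 ?(ltW a0)//.
by rewrite -powRrM mulVf// powRr1 ?(ltW w0)// -powR_inv1 ?(ltW a0)// -powRrM mulN1r.
Qed.

End hypotheses.

(** * The Lorentz bound for sums of atoms *)

Lemma lorentz_norm_ae_le (R : realType) n (p : R) (r : \bar R)
    (g h : Rn R n -> \bar R) : 0 < p -> (0 < r)%E ->
  {ae @leb R n, forall x, (`|g x| <= `|h x|)%E} ->
  (lorentz_norm p r g <= lorentz_norm p r h)%E.
Proof.
move=> p0 r0 gh; apply: lorentz_norm_le => // t t0; apply: rearrangement_mono => a a0.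
exact: distribution_ae_le.
Qed.

Lemma lt_poweR_inv (R : realType) (a v : R) (x : \bar R) : 0 < v -> 0 <= a ->
  (0 <= x -> (a%:E < x `^ v^-1) = ((a `^ v)%:E < x))%E.
Proof.
move=> v0 a0 x0; have v0' := ltW v0; rewrite !ltNge; congr negb; apply/idP/idP => xa.
  have := ge0_le_poweR v0' (poweR_ge0 _ _) xa.
  by rewrite -poweRrM mulVf ?gt_eqF// poweRe1.
have vi : 0 <= v^-1 by rewrite invr_ge0.
have := ge0_le_poweR vi x0 xa.
by rewrite poweR_EFin -powRrM mulfV ?gt_eqF// powRr1.
Qed.

(** The weak type (1,1) of the maximal function along the cubes [Q j]; the constant is that of the
    tripled cubes. *)
Lemma cube_weak_type (R : realType) n (Q : nat -> set (Rn R n)) (A : set (Rn R n))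
    (e : R) (J : set nat) : (0 < n)%N -> (forall j, is_cube (Q j)) ->
  measurable A -> 0 <= e ->
  (forall j, J j -> (e%:E * leb (Q j) <= leb (A `&` Q j))%E) ->
  (e%:E * leb (\bigcup_(j in J) Q j) <= (3 ^+ n)%:E * leb A)%E.
Proof.
move=> n0 cQ mA e0 QA.
have /choice[W WP] := fun j => cube_tripling n0 (cQ j).
apply: (@vitali_weak_type _ _ _ (@leb R n) Q W) => //.
- by move=> j; exact: measurable_cube.
- by move=> j; have [] := WP j.
- move=> j; have [_ WE _] := WP j.
  by rewrite le_eqVlt; apply/orP; left; apply/eqP; exact: WE.
- by move=> i j ij QQ; have [_ _ WQ] := WP i; exact: WQ.
move=> j; apply/set0P/eqP => Qj0; have [l l0] := leb_cubeE (cQ j).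
by rewrite Qj0 measure0 => -[] l0'; rewrite -l0' ltxx in l0.
Qed.

(** For [A j = |a_j|] this is the majorant of the series of atoms; with the indicators of the [Q j]
    as [A] it unfolds to [cube_sum]. *)
Definition atom_sum (R : realType) n (v : R) (lambda : nat -> R)
    (A : nat -> Rn R n -> R) : Rn R n -> \bar R :=
  fun x => ((\sum_(0 <= j <oo) ((lambda j * A j x) `^ v)%:E) `^ v^-1)%E.

Lemma atom_sum_lorentz (R : realType) n (p t v : R) (r : \bar R) :
  (0 < n)%N -> 0 < p -> p < t -> (0 < r)%E -> 0 < v -> v < p ->
  exists2 C : R, 0 < C &
  forall (Q : nat -> set (Rn R n)) (A : nat -> Rn R n -> R) (lambda : nat -> R),
  (forall j, is_cube (Q j)) -> (forall j, 0 <= lambda j) ->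
  (forall j, measurable_fun [set: Rn R n] (A j)) ->
  (forall j x, 0 <= A j x) -> (forall j x, ~ Q j x -> A j x = 0) ->
  (forall j (e : R), 0 < e ->
    (leb [set x | (e < A j x)%R] <= leb (Q j) * (e `^ (- t))%:E)%E) ->
  (lorentz_norm p r (atom_sum v lambda A)
     <= C%:E * lorentz_norm p r (cube_sum v lambda Q))%E.
Proof.
move=> n0 p0 pt r0 v0 vp.
have t0 : 0 < t by exact: lt_trans pt.
(* The midpoint of [p/v] and [t/v]: [distribution_estimate] asks for [q < t/v], and the summation of
   the dilations for [p/v < q]. *)
pose q := (p + t) / 2 / v.
have pq : p / v < q by rewrite ltr_pM2r ?invr_gt0//; lra.
have qt : q < t / v by rewrite ltr_pM2r ?invr_gt0//; lra.
have tv : 1 < t / v by rewrite ltr_pdivlMr// mul1r (lt_trans vp).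
have K0 : 0 < 3 ^+ n :> R by rewrite exprn_gt0.
have [kappa kappa0 estimate] := distribution_estimate (@leb R n) K0 tv qt.
have two0 x : 0 < 2 `^ x :> R by rewrite powR_gt0.
(* Here [rho = 2^(1/v)], since halving the level of a sum divides that of its power [1/v] by
   [2^(1/v)], and [sigma = 2^q]. *)
have rho_sigma : (2 `^ v^-1) `^ p < 2 `^ q.
  have two_gt1 : 1 < 2 `^ (q - p / v) :> R.
    by rewrite powR2_gt1// subr_gt0.
  rewrite -powRrM mulrC -[q](subrK (p / v)) powRD; last first.
    by rewrite pnatr_eq0 implybT.
  by rewrite ltr_pMl.
have [C C0 CP] := lorentz_norm_dilation p0 r0 kappa0 (two0 v^-1) (two0 q) rho_sigma.
exists C => // Q A lambda cQ l0 mA A0 AQ weakA; apply: CP => gam tau gam0 tau0 levels.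
pose w j := fine (leb (Q j)).
have wE j : leb (Q j) = (w j)%:E.
  by rewrite /w; have [l _ ->] := leb_cubeE (cQ j).
have w0 j : 0 < w j by rewrite /w; have [l l0' ->] := leb_cubeE (cQ j).
have pw j x : 0 <= lambda j `^ v * A j x `^ v by rewrite mulr_ge0 ?powR_ge0.
(* The outer exponent [1/v] only changes the level [a] into [a^v]. *)
have superlevel (B : nat -> Rn R n -> R) (a : R) : 0 < a -> (forall j x, 0 <= B j x) ->
    [set x | a%:E < `|(\sum_(0 <= j <oo) ((lambda j * B j x) `^ v)%:E) `^ v^-1| ]%E =
    [set x | ((a `^ v)%:E < \sum_(0 <= j <oo) (lambda j `^ v * B j x `^ v)%:E)%E].
  move=> a0 B0.
  have sumE x : (\sum_(0 <= j <oo) ((lambda j * B j x) `^ v)%:E =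
      \sum_(0 <= j <oo) (lambda j `^ v * B j x `^ v)%:E)%E.
    by apply: eq_eseriesr => j _; rewrite powRM.
  have sum0 x : (0 <= \sum_(0 <= j <oo) (lambda j `^ v * B j x `^ v)%:E)%E.
    by apply: nneseries_ge0 => j _ _; rewrite lee_fin mulr_ge0 ?powR_ge0.
  by apply/seteqP; split => x /=;
    rewrite sumE gee0_abs ?poweR_ge0// lt_poweR_inv// ltW.
have mQ j : measurable (Q j) by exact: measurable_cube.
have c0 j : 0 <= lambda j `^ v by exact: powR_ge0.
have mB j : measurable_fun [set: Rn R n] (fun x => A j x `^ v).
  exact: (measurableT_comp (measurable_powR v) (mA j)).
have B0 j x : 0 <= A j x `^ v by exact: powR_ge0.
have BQ j x : ~ Q j x -> A j x `^ v = 0.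
  by move=> Qx; rewrite AQ// powR0// gt_eqF.
have weakB j e : 0 < e ->
    (leb [set x | (e < A j x `^ v)%R] <= (w j * e `^ (- (t / v)))%:E)%E.
  move=> e0; have ev0 : 0 < e `^ v^-1 by rewrite powR_gt0.
  have -> : [set x | e < A j x `^ v] = [set x | e `^ v^-1 < A j x].
    apply/seteqP; split => x /=; have := @lt_poweR_inv R e v^-1 (A j x)%:E;
      by rewrite invrK invr_gt0 lee_fin poweR_EFin !lte_fin => ->//; exact: ltW.
  apply: (le_trans (weakA j _ ev0)); rewrite wE -EFinM lee_fin.
  by rewrite -powRrM mulrN [v^-1 * t]mulrC.
have levelsB i : (leb [set x | ((gam `^ v / 2 ^+ i)%:E <
    \sum_(0 <= j <oo) (lambda j `^ v * \1_(Q j) x)%:E)%E] <=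
    (kappa * (2 `^ q) ^+ i * tau)%:E)%E.
  have gi : 0 < gam / (2 `^ v^-1) ^+ i by rewrite divr_gt0// exprn_gt0.
  have := levels i; rewrite /distribution_function /cube_sum.
  rewrite (superlevel (fun j x => \1_(Q j) x))//.
  have -> : (gam / (2 `^ v^-1) ^+ i) `^ v = gam `^ v / 2 ^+ i.
    rewrite powRM ?invr_ge0 ?exprn_ge0 ?(ltW gam0)// -powR_inv1 ?exprn_ge0//.
    by rewrite powRAC powR_exprn// -powRrM mulVf ?gt_eqF// powRr1// powR_inv1.
  move=> level_i; apply: (le_trans (leb_le _) level_i) => x /= /lt_le_trans; apply.
  rewrite le_eqVlt; apply/orP; left; apply/eqP; apply: eq_eseriesr => j _.
  (* An indicator equals its power [v], as [0^v] is 0 for nonzero [v]. *)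
  by rewrite indicE; case: (x \in Q j); rewrite ?powR1 ?powR0 ?gt_eqF.
rewrite /distribution_function /atom_sum superlevel//.
exact: (estimate Q w (fun j => lambda j `^ v) (fun j x => A j x `^ v) (gam `^ v) tau
  mQ w0 wE (fun B e J mB e0 => cube_weak_type n0 cQ mB e0) c0 mB B0 BQ weakB
  (powR_gt0 v gam0) tau0 levelsB).
Qed.

(** * Series of atoms *)

(** A number [z] in [[0, 1]] satisfies [z <= z^v]; this is applied to [x/(x+y)] and [y/(x+y)], whose
    sum is 1. *)
Lemma powR_subadditive (R : realType) (x y v : R) : 0 <= x -> 0 <= y -> 0 < v <= 1 ->
  (x + y) `^ v <= x `^ v + y `^ v.
Proof.
move=> x0 y0 /andP[v0 v1]; have [->|xn0] := eqVneq x 0.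
  by rewrite add0r powR0 ?gt_eqF// add0r.
have xp : 0 < x by rewrite lt_neqAle eq_sym xn0.
have s0 : 0 < x + y by rewrite ltr_wpDr.
have frac z : 0 <= z -> z <= x + y -> z / (x + y) <= z `^ v / (x + y) `^ v.
  move=> z0 zs; have [->|zn0] := eqVneq z 0.
    by rewrite powR0 ?gt_eqF// !mul0r.
  have zp : 0 < z by rewrite lt_neqAle eq_sym zn0.
  have -> : z `^ v / (x + y) `^ v = (z / (x + y)) `^ v.
    by rewrite powRM ?invr_ge0 ?(ltW s0)// -powRN -mulN1r powRrM powR_inv1 ?(ltW s0).
  by apply: ger1_powR => //; rewrite divr_gt0// ler_pdivrMr// mul1r.
have := lerD (frac x x0 _) (frac y y0 _); rewrite lerDl lerDr => /(_ y0 x0).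
by rewrite -!mulrDl divff ?gt_eqF// ler_pdivlMr ?powR_gt0// mul1r.
Qed.

Lemma powR_sum_subadditive (R : realType) (I : Type) (s : seq I) (x : I -> R) (v : R) :
  (forall i, 0 <= x i) -> 0 < v <= 1 ->
  (\sum_(i <- s) x i) `^ v <= \sum_(i <- s) x i `^ v.
Proof.
move=> x0 v01; elim: s => [|i s IH].
  by rewrite !big_nil powR0// gt_eqF//; case/andP: v01.
rewrite !big_cons; apply: (le_trans (powR_subadditive _ _ v01)) => //.
  exact: sumr_ge0.
by rewrite lerD2l.
Qed.

(** The inequality between the l^1 and l^v quasi-norms for [v <= 1]. A start at [N] serves for the
    tails of the series of atoms. *)
Lemma sum_le_atom_sum (R : realType) n (v : R) (lambda : nat -> R)
    (A : nat -> Rn R n -> R) (N M : nat) (x : Rn R n) : 0 < v <= 1 ->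
  (forall j, 0 <= lambda j) -> (forall j x, 0 <= A j x) ->
  ((\sum_(N <= j < M) lambda j * A j x)%:E <=
    atom_sum v (fun j => lambda (N + j)%N) (fun j => A (N + j)%N) x)%E.
Proof.
move=> v01 l0 A0; have /andP[v0 v1] := v01.
have t0 j : 0 <= lambda j * A j x by rewrite mulr_ge0.
set S := \sum_(N <= j < M) _; have S0 : 0 <= S by exact: sumr_ge0.
have -> : S%:E = ((S `^ v)%:E `^ v^-1)%E.
  by rewrite poweR_EFin -powRrM mulfV ?gt_eqF// powRr1.
apply: ge0_le_poweR; [by rewrite invr_ge0 ltW|by rewrite lee_fin powR_ge0|].
apply: (@le_trans _ _ (\sum_(0 <= j < M - N)
    ((lambda (N + j)%N * A (N + j)%N x) `^ v)%:E)%E); last first.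
  by apply: nneseries_lim_ge => j _ _; rewrite lee_fin powR_ge0.
rewrite sumEFin lee_fin /S -{1}[N]add0n big_addn.
under eq_bigr do rewrite addnC.
exact: (@powR_sum_subadditive _ _ _ (fun j => lambda (N + j)%N * A (N + j)%N x)).
Qed.

(** * Complex series and their limits *)

Section complex_series.
Variable R : realType.
Implicit Types (z : R[i]) (u : nat -> R[i]).

Lemma normc_real (l : R) : Normc.normc (l%:C)%C = `|l|.
Proof. by rewrite /= expr0n/= addr0 sqrtr_sqr. Qed.

Lemma normc_le_sum z : Normc.normc z <= `|complex.Re z| + `|complex.Im z|.
Proof.
have -> : z = ((complex.Re z)%:C + 'i * (complex.Im z)%:C)%C by exact: complexE.
apply: (le_trans (le_normcD _ _)); rewrite Normc.normcM !normc_real.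
have -> : Normc.normc 'i%C = 1 :> R by rewrite /= expr0n/= add0r expr1n sqrtr1.
by case: z => a b /=; rewrite !(mul1r, mul0r, subr0, sub0r, addr0, add0r, mulr0, mulr1).
Qed.

Lemma Re_le_normc z : `|complex.Re z| <= Normc.normc z.
Proof.
case: z => a b /=; rewrite -sqrtr_sqr ler_sqrt ?addr_ge0 ?sqr_ge0//.
by rewrite lerDl sqr_ge0.
Qed.

Lemma Im_le_normc z : `|complex.Im z| <= Normc.normc z.
Proof.
case: z => a b /=; rewrite -sqrtr_sqr ler_sqrt ?addr_ge0 ?sqr_ge0//.
by rewrite lerDr sqr_ge0.
Qed.

Lemma normcB_near u (a b e : R) : 0 < e ->
  complex.Re (u k) @[k --> \oo] --> a -> complex.Im (u k) @[k --> \oo] --> b ->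
  \forall k \near \oo, Normc.normc (Complex a b - u k) < e.
Proof.
move=> e0 /cvgrPdist_lt ua /cvgrPdist_lt ub; near=> k.
apply: (le_lt_trans (normc_le_sum _)).
have -> : complex.Re (Complex a b - u k) = a - complex.Re (u k) by case: (u k).
have -> : complex.Im (Complex a b - u k) = b - complex.Im (u k) by case: (u k).
rewrite [ltRHS]splitr ltrD//; near: k; [apply: ua|apply: ub]; exact: divr_gt0.
Unshelve. all: by end_near. Qed.

Lemma complex_cvg u (a b : R) :
  complex.Re (u k) @[k --> \oo] --> a -> complex.Im (u k) @[k --> \oo] --> b ->
  (u k : R[i]^o) @[k --> \oo] --> (Complex a b : R[i]^o).
Proof.
move=> ua ub; apply/cvgrPdist_lt => e e0.
(* A positive element of [R[i]] is real. *)
have eE : e = ((complex.Re e)%:C)%C.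
  by case: e e0 => x y; rewrite ltcE/= => /andP[/eqP ->].
have re0 : 0 < complex.Re e by move: e0; rewrite ltcE => /andP[].
have := normcB_near re0 ua ub; apply: filterS => k; rewrite eE.
set z := _ - u k.
have -> : `|(Complex a b : R[i]^o) - u k| = ((Normc.normc z)%:C)%C.
  by [].
by rewrite ltcR.
Qed.

End complex_series.

Section atomic_series.
Context {R : realType} {n : nat} (v : R) (lambda : nat -> R)
  (a : nat -> Rn R n -> R[i]) (A : nat -> Rn R n -> R).
Hypotheses (v01 : 0 < v <= 1) (lambda0 : forall j, 0 <= lambda j).
Hypothesis L0a : forall j, L0 (a j).
Hypotheses (mA : forall j, measurable_fun [set: Rn R n] (A j))
  (A0 : forall j x, 0 <= A j x).

Let Z := [set x | (atom_sum v lambda A x < +oo)%E].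
Let reS N x := \sum_(0 <= j < N) lambda j * complex.Re (a j x).
Let imS N x := \sum_(0 <= j < N) lambda j * complex.Im (a j x).

(** Where the real limits do not exist, [limn] is a default value; the function is therefore used
    only on the set [Z]. *)
Definition atomic_limit (x : Rn R n) : R[i] :=
  Complex (limn (reS ^~ x)) (limn (imS ^~ x)).

Lemma partial_sum_parts N x :
  complex.Re (partial_sum lambda a N x) = reS N x /\
  complex.Im (partial_sum lambda a N x) = imS N x.
Proof.
rewrite /partial_sum /reS /imS !big_mkord; elim: N => [|N IH]; first by rewrite !big_ord0.
rewrite !big_ord_recr /= -(IH.1) -(IH.2).
case: (\sum_(i < N) _) => u w /=; case: (a N x) => b c /=.
by split; ring.
Qed.

Lemma partial_sum_L0 N : L0 (partial_sum lambda a N).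
Proof.
have part_sum (part : R[i] -> R) :
    (forall j, measurable_fun [set: Rn R n] (fun x => part (a j x))) ->
    measurable_fun [set: Rn R n] (fun x => \sum_(0 <= j < N) lambda j * part (a j x)).
  move=> mpart; apply: (@measurable_sum _ _ _ _ _ _ (fun j x => lambda j * part (a j x))).
  by move=> j; apply: measurable_funM; [exact: measurable_cst|exact: mpart].
split.
  rewrite (_ : (fun x => _) = reS N); last by apply/funext => x; case: (partial_sum_parts N x).
  by apply: part_sum => j; case: (L0a j).
rewrite (_ : (fun x => _) = imS N); last by apply/funext => x; case: (partial_sum_parts N x).
by apply: part_sum => j; case: (L0a j).
Qed.

Lemma measurable_atom_sum : measurable_fun [set: Rn R n] (atom_sum v lambda A).
Proof.
apply: (measurableT_comp (measurable_poweR _)).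
apply: measurable_nneseries => [j x _|j]; first by rewrite lee_fin powR_ge0.
apply/measurable_EFinP; apply: (measurableT_comp (measurable_powR _)).
exact: measurable_funM.
Qed.

Section pointwise.
Variable x : Rn R n.
Hypotheses (Zx : Z x) (aA : forall j, Normc.normc (a j x) <= A j x).

Let summable : cvgn (series (fun j => lambda j * A j x)).
Proof.
apply: (@nnseries_is_cvg _ (fun j => lambda j * A j x)) => [j|]; first by rewrite mulr_ge0.
apply: le_lt_trans Zx; apply: lime_le.
  by apply: is_cvg_nneseries => j _ _; rewrite lee_fin mulr_ge0.
apply: nearW => M; rewrite sumEFin.
exact: (sum_le_atom_sum 0 M x v01 lambda0 A0).
Qed.

Let part_cvg (part : R[i] -> R) : (forall z, `|part z| <= Normc.normc z) ->
  cvgn (fun N => \sum_(0 <= j < N) lambda j * part (a j x)).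
Proof.
move=> part_le; apply: (@normed_cvg _ _ (fun j => lambda j * part (a j x))).
apply: series_le_cvg summable => j /=; [exact: normr_ge0|exact: mulr_ge0|].
rewrite /= normrM ger0_norm// ler_wpM2l//.
exact: le_trans (part_le _) (aA j).
Qed.

Lemma atomic_limit_cvg :
  (partial_sum lambda a N x : R[i]^o) @[N --> \oo] --> (atomic_limit x : R[i]^o).
Proof.
apply: complex_cvg.
  under eq_fun do rewrite (partial_sum_parts _ _).1.
  exact: part_cvg (@Re_le_normc R).
under eq_fun do rewrite (partial_sum_parts _ _).2.
exact: part_cvg (@Im_le_normc R).
Qed.

Lemma partial_sumB_le N M : (N <= M)%N ->
  Normc.normc (partial_sum lambda a M x - partial_sum lambda a N x) <=
    \sum_(N <= j < M) lambda j * A j x.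
Proof.
move=> NM; rewrite /partial_sum -!(big_mkord xpredT (fun j => (lambda j)%:C%C * a j x)).
rewrite (big_cat_nat (leq0n N) NM) /= addrAC subrr add0r.
elim: M NM => [|M IH]; first by rewrite leqn0 => /eqP ->; rewrite !big_geq// Normc.normc0.
rewrite leq_eqVlt => /predU1P[->|NM]; first by rewrite !big_geq// Normc.normc0.
rewrite !big_nat_recr//=; apply: (le_trans (le_normcD _ _)); apply: lerD; first exact: IH.
rewrite Normc.normcM normc_real ger0_norm//.
by rewrite ler_wpM2l.
Qed.

(** The limit is within [e] of some partial sum of index [M >= N], and only terms of the tail
    separate the partial sums of indices [N] and [M]. The case [N = 0] bounds the limit itself. *)
Lemma atomic_limitB_le N :
  ((Normc.normc (atomic_limit x - partial_sum lambda a N x))%:E <=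
    atom_sum v (fun j => lambda (N + j)%N) (fun j => A (N + j)%N) x)%E.
Proof.
apply/lee_addgt0Pr => e e0.
have reC : complex.Re (partial_sum lambda a k x) @[k --> \oo] --> limn (reS ^~ x).
  under eq_fun do rewrite (partial_sum_parts _ _).1.
  exact: part_cvg (@Re_le_normc R).
have imC : complex.Im (partial_sum lambda a k x) @[k --> \oo] --> limn (imS ^~ x).
  under eq_fun do rewrite (partial_sum_parts _ _).2.
  exact: part_cvg (@Im_le_normc R).
have [M _ /(_ (maxn N M) (leq_maxr _ _)) ltM] := normcB_near e0 reC imC.
apply: (@le_trans _ _ ((\sum_(N <= j < maxn N M) lambda j * A j x)%:E + e%:E)%E); last first.
  by apply: leeD => //; exact: sum_le_atom_sum.
rewrite -EFinD lee_fin [leRHS]addrC.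
rewrite -(subrKA (partial_sum lambda a (maxn N M) x)).
apply: (le_trans (le_normcD _ _)); apply: lerD; first exact: (ltW ltM).
exact: partial_sumB_le (leq_maxl _ _).
Qed.

Lemma partial_sum_le N :
  ((Normc.normc (partial_sum lambda a N x))%:E <= atom_sum v lambda A x)%E.
Proof.
have := partial_sumB_le (leq0n N); rewrite {2}/partial_sum big_ord0 subr0 => le_sum.
apply: (@le_trans _ _ (\sum_(0 <= j < N) lambda j * A j x)%:E); first by rewrite lee_fin.
exact: (sum_le_atom_sum 0 N x v01 lambda0 A0).
Qed.

Lemma part_limit_cvg : (reS N x @[N --> \oo] --> limn (reS ^~ x)) /\
  (imS N x @[N --> \oo] --> limn (imS ^~ x)).
Proof.
by split; [exact: part_cvg (@Re_le_normc R)|exact: part_cvg (@Im_le_normc R)].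
Qed.

End pointwise.
End atomic_series.

(** The bound for atoms applies to shifted families, whereas monotonicity in [k] is plain for the
    tails of one fixed series. *)
Lemma cube_sum_tailE (R : realType) n (v : R) (lambda : nat -> R)
    (Q : nat -> set (Rn R n)) (k : nat) (x : Rn R n) :
  cube_sum v (fun j => lambda (k + j)%N) (fun j => Q (k + j)%N) x =
  ((\sum_(k <= j <oo) ((lambda j * \1_(Q j) x) `^ v)%:E) `^ v^-1)%E.
Proof.
pose u j := ((lambda j * \1_(Q j) x) `^ v)%:E.
have u0 j : (0 <= u j)%E by rewrite lee_fin powR_ge0.
transitivity ((\sum_(k <= j <oo) u j) `^ v^-1)%E; last by [].
rewrite -(nneseries_addn k u0) /cube_sum; congr poweR.
by apply: eq_eseriesr => j _; rewrite addnC.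
Qed.

(** The tails decrease, and tend to 0 wherever the full sum is finite, hence almost everywhere;
    [lorentz_norm_cvg0] applies. *)
Lemma lorentz_norm_cube_sum_tail (R : realType) n (p r v : R) (lambda : nat -> R)
    (Q : nat -> set (Rn R n)) : 0 < p -> 0 < r -> 0 < v ->
  (forall j, is_cube (Q j)) ->
  (lorentz_norm p r%:E (cube_sum v lambda Q) < +oo)%E ->
  (lorentz_norm p r%:E (cube_sum v (fun j => lambda (k + j)%N) (fun j => Q (k + j)%N))
    @[k --> \oo] --> 0)%E.
Proof.
move=> p0 r0 v0 cQ Ffin.
pose u (j : nat) (x : Rn R n) : \bar R := ((lambda j * \1_(Q j) x) `^ v)%:E.
have u0 j x : (0 <= u j x)%E by rewrite lee_fin powR_ge0.
have vi : 0 < v^-1 by rewrite invr_gt0.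
pose F k := cube_sum v (fun j => lambda (k + j)%N) (fun j => Q (k + j)%N).
have tail0 k x : (0 <= \sum_(k <= j <oo) u j x)%E by exact: nneseries_ge0.
have mcube l (P : nat -> set (Rn R n)) : (forall j, is_cube (P j)) ->
    measurable_fun [set: Rn R n] (cube_sum v l P).
  move=> cP; apply: measurable_atom_sum => j; apply: measurable_indic.
  exact: measurable_cube.
have r0' : (0 < r%:E)%E by rewrite lte_fin.
apply: (@lorentz_norm_cvg0 _ _ p r F p0 r0).
- by move=> k x; exact: poweR_ge0.
- by move=> k; apply: mcube.
- move=> k x; rewrite /F !cube_sum_tailE; apply: ge0_le_poweR; rewrite ?(ltW vi)//.
    exact: tail0.
  have -> : (\sum_(k <= j <oo) ((lambda j * \1_(Q j) x) `^ v)%:E =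
      u k x + \sum_(k.+1 <= j <oo) u j x)%E.
    rewrite (nneseries_split k 1%N); last by move=> j _; exact: u0.
    by rewrite addn1 big_nat1.
  by rewrite leeDr.
- exact: Ffin.
- have := lorentz_ae_fin p0 r0' Ffin (mcube lambda Q cQ).
  apply: filterS => x; rewrite gee0_abs ?poweR_ge0// => Fx.
  have Sx : (\sum_(0 <= j <oo) u j x < +oo)%E.
    by apply: lty_poweRy Fx; rewrite invr_eq0 gt_eqF.
  have tail_cvg := nneseries_tail_cvg Sx (fun j _ => u0 j x).
  apply/ereal_cvg0P => [k|e e0]; first exact: poweR_ge0.
  have := (ereal_cvg0P (fun k => tail0 k x)).1 tail_cvg _ (powR_gt0 v e0).
  apply: filterS => k tk; rewrite /F cube_sum_tailE.
  apply: (@le_trans _ _ ((e `^ v)%:E `^ v^-1)%E).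
    by apply: ge0_le_poweR; rewrite ?(ltW vi)//; exact: tail0.
  by rewrite poweR_EFin -powRrM mulfV ?gt_eqF// powRr1// ltW.
Qed.

(** Set to 0 off [Z], the limit is everywhere the pointwise limit of the measurable functions
    obtained from the partial sums by multiplication with the indicator of [Z]. *)
Lemma restricted_limit_L0 (R : realType) n (v : R) (lambda : nat -> R)
    (a : nat -> Rn R n -> R[i]) : 0 < v <= 1 -> (forall j, 0 <= lambda j) ->
  (forall j, L0 (a j)) ->
  let Z := [set x | (atom_sum v lambda (fun j x => Normc.normc (a j x)) x < +oo)%E] in
  L0 (fun x => if `[< Z x >] then atomic_limit lambda a x else 0).
Proof.
move=> v01 l0 La Z.
have mnorm j := measurable_normc (La j).
have norm0 j x : 0 <= Normc.normc (a j x) by exact: normc_ge0.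
have mZ : measurable Z.
  have := emeasurable_fun_infty_o measurableT (measurable_atom_sum v lambda mnorm) +oo%E.
  by rewrite setTI.
have part (part : R[i] -> R) : part 0 = 0 ->
    (forall N, measurable_fun [set: Rn R n] (fun x => part (partial_sum lambda a N x))) ->
    (forall x, Z x -> part (partial_sum lambda a N x) @[N --> \oo] -->
      part (atomic_limit lambda a x)) ->
    measurable_fun [set: Rn R n]
      (fun x => part (if `[< Z x >] then atomic_limit lambda a x else 0)).
  move=> part0 mpart cpart.
  apply: (@measurable_fun_cvg _ _ _ _
    (fun N x => part (partial_sum lambda a N x) * \1_Z x)).
    by move=> N; apply: measurable_funM => //; exact: measurable_indic.
  move=> x _; have [Zx|nZx] := pselect (Z x).
    rewrite asboolT//; under eq_fun do rewrite indicE mem_set// mulr1.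
    exact: cpart.
  rewrite asboolF// part0; under eq_fun do rewrite indicE memNset// mulr0.
  exact: cvg_cst.
split.
  apply: (part (@complex.Re R)); first by [].
    by move=> N; case: (partial_sum_L0 lambda La N).
  move=> x Zx; under eq_fun do rewrite (partial_sum_parts lambda a _ _).1.
  by case: (part_limit_cvg v01 l0 norm0 Zx (fun j => lexx _)).
apply: (part (@complex.Im R)); first by [].
  by move=> N; case: (partial_sum_L0 lambda La N).
move=> x Zx; under eq_fun do rewrite (partial_sum_parts lambda a _ _).2.
by case: (part_limit_cvg v01 l0 norm0 Zx (fun j => lexx _)).
Qed.

Theorem corollary1p2 (R : realType) (n : nat) (hn : (0 < n)%N)
  (p s t v : R) (r : \bar R)
  (hp : 0 < p) (hpt : p < t) (hts : t <= s)
  (hr : (0 < r)%E)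
  (hv0 : 0 < v) (hv1 : v <= 1) (hv : (v%:E < Order.min p%:E r)%E) :
  exists2 C : R, 0 < C &
  forall (Q : nat -> set (Rn R n)) (a : nat -> Rn R n -> R[i])
    (lambda : nat -> R),
    (forall j, is_cube (Q j)) ->
    (forall j, weak_morrey s t (a j)) ->
    (forall j, 0 <= lambda j) ->
    (forall j, (weak_morrey_norm s t (modulus (a j)) <= leb (Q j) `^ s^-1)%E) ->
    (forall j, supp (a j) `<=` Q j) ->
    (lorentz_norm p r (cube_sum v lambda Q) < +oo)%E ->
    exists f : Rn R n -> R[i],
      [/\ L0 f,
          {ae leb (n:=n), forall x,
            (partial_sum lambda a N x : R[i]^o) @[N --> \oo] --> (f x : R[i]^o)},
          (lorentz_norm p r (modulus f)
             <= C%:E * lorentz_norm p r (cube_sum v lambda Q))%E &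
          (r < +oo)%E ->
            [/\ lorentz p r f,
                forall N, lorentz p r (partial_sum lambda a N) &
                lorentz_norm p r (modulus (fun x => f x - partial_sum lambda a N x))
                  @[N --> \oo] --> 0%E]].
Proof.
have vp : v < p by rewrite -lte_fin; move: hv; rewrite lt_min => /andP[].
have v01 : 0 < v <= 1 by rewrite hv0.
have t0 : 0 < t by exact: lt_trans hpt.
have [C C0 CP] := atom_sum_lorentz hn hp hpt hr hv0 vp.
exists C => // Q a lambda cQ wa l0 na sa Ffin.
(* The truncated atoms agree with the [a j] almost everywhere, and their series
   converges at every point of the measurable set [Z]. *)
pose a' j x : R[i] := if `[< Q j x >] then a j x else 0.
pose A j x := Normc.normc (a' j x).
have a'E part : part 0 = 0 :> R -> forall j,
    (fun x => part (a' j x)) = (fun x => part (a j x) * \1_(Q j) x).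
  move=> part0 j; apply/funext => x; rewrite /a' indicE.
  by have [Qx|nQx] := pselect (Q j x);
    [rewrite asboolT// mem_set// mulr1|rewrite asboolF// memNset// part0 mulr0].
have La' j : L0 (a' j).
  have mQ : measurable_fun [set: Rn R n] (\1_(Q j) : _ -> R).
    by apply: measurable_indic; exact: measurable_cube.
  have [[mre mim] _] := wa j.
  split.
    rewrite (a'E (@complex.Re R) erefl j); exact: (measurable_funM mre mQ).
  rewrite (a'E (@complex.Im R) erefl j); exact: (measurable_funM mim mQ).
have A0 j x : 0 <= A j x by exact: normc_ge0.
have mA j : measurable_fun [set: Rn R n] (A j) by exact: measurable_normc.
have AQ j x : ~ Q j x -> A j x = 0.
  by move=> Qx; rewrite /A /a' asboolF// Normc.normc0.
have weakA j (e : R) : 0 < e ->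
    (leb [set x | (e < A j x)%R] <= leb (Q j) * (e `^ (- t))%:E)%E.
  move=> e0; have [w w0 wE] := leb_cubeE (cQ j).
  have [Laj _] := wa j.
  have := weak_morrey_distribution t0 (cQ j) w0 wE Laj (na j) e0.
  rewrite wE -EFinM; apply: le_trans; apply: leb_le => x /=; rewrite /A /a'.
  case: asboolP => [Qx ea|_]; first by split.
  by rewrite Normc.normc0 ltNge ltW.
pose g := atom_sum v lambda A.
pose Z := [set x | (g x < +oo)%E].
have Cfin : (C%:E * lorentz_norm p r (cube_sum v lambda Q) < +oo)%E.
  by apply: lte_mul_pinfty; [rewrite lee_fin; exact: ltW|by []|exact: Ffin].
have gfin : (lorentz_norm p r g < +oo)%E.
  exact: le_lt_trans (CP Q A lambda cQ l0 mA A0 AQ weakA) Cfin.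
have mg : measurable_fun [set: Rn R n] g by exact: measurable_atom_sum.
have g0 x : (0 <= g x)%E by exact: poweR_ge0.
have aeZ : {ae @leb R n, forall x, Z x}.
  have := lorentz_ae_fin hp hr gfin mg; apply: filterS => x.
  by rewrite gee0_abs.
have aea : {ae @leb R n, forall x j, a j x = a' j x}.
  apply/ae_foralln => j; have := supp_ae (sa j); apply: filterS => x ax.
  by rewrite /a'; case: asboolP => // /ax.
have aeS : {ae @leb R n, forall x N, partial_sum lambda a N x = partial_sum lambda a' N x}.
  apply: filterS aea => x aE N; rewrite /partial_sum.
  by apply: eq_bigr => j _; rewrite aE.
(* The value 0 on the null complement of [Z] makes [f] measurable and gives [|f| <= |g|]
   everywhere. *)
pose f x := if `[< Z x >] then atomic_limit lambda a' x else 0.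
have modE (h : Rn R n -> R[i]) x : (`|modulus h x| = (Normc.normc (h x))%:E)%E.
  by rewrite /modulus gee0_abs// lee_fin normc_ge0.
have fg x : (`|modulus f x| <= `|g x|)%E.
  rewrite modE (gee0_abs (g0 x)) /f; case: asboolP => [Zx|_]; last first.
    by rewrite Normc.normc0.
  (* The partial sum of index 0 vanishes. *)
  have := atomic_limitB_le v01 l0 A0 Zx (fun j => lexx _) 0.
  by rewrite {1}/partial_sum big_ord0 subr0.
have normf : (lorentz_norm p r (modulus f) <= C%:E * lorentz_norm p r (cube_sum v lambda Q))%E.
  apply: le_trans (CP Q A lambda cQ l0 mA A0 AQ weakA).
  by apply: lorentz_norm_ae_le => //; exact: aeW.
have Lf : L0 f by exact: restricted_limit_L0.
exists f; split; [exact: Lf| |exact: normf|].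
  apply: filterS2 aeS aeZ => x Sx Zx.
  rewrite /f asboolT//; under eq_fun do rewrite Sx.
  exact: (atomic_limit_cvg v01 l0 A0 Zx (fun j => lexx _)).
move=> rfin; split; [split; [exact: Lf|exact: le_lt_trans normf Cfin]| |].
  move=> N; split; first by apply: partial_sum_L0 => j; case: (wa j).
  apply: le_lt_trans gfin; apply: lorentz_norm_ae_le => //.
  apply: filterS2 aeS aeZ => x Sx Zx; rewrite modE (gee0_abs (g0 x)) Sx.
  exact: (partial_sum_le v01 l0 A0 (fun j => lexx _)).
have [r' rE] : exists r' : R, r = r'%:E.
  by move: hr rfin; case: (r) => [r'| |]// _ _; exists r'.
have r'0 : 0 < r' by rewrite -lte_fin -rE.
(* The shifted families satisfy the same hypotheses, so the same constant [C] bounds the tails. *)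
pose F k := cube_sum v (fun j => lambda (k + j)%N) (fun j => Q (k + j)%N).
pose G k := atom_sum v (fun j => lambda (k + j)%N) (fun j => A (k + j)%N).
have GF k : (lorentz_norm p r (G k) <= C%:E * lorentz_norm p r (F k))%E.
  exact: (CP _ _ _ (fun j => cQ _) (fun j => l0 _) (fun j => mA _) (fun j => A0 _)
    (fun j => AQ _) (fun j => weakA _)).
have fG k : (lorentz_norm p r (modulus (fun x => (f x - partial_sum lambda a k x)%R))
    <= lorentz_norm p r (G k))%E.
  apply: lorentz_norm_ae_le => //; apply: filterS2 aeS aeZ => x Sx Zx.
  rewrite modE (gee0_abs (poweR_ge0 _ _)) Sx /f asboolT//.
  exact: (atomic_limitB_le v01 l0 A0 Zx (fun j => lexx _)).
apply: (@squeeze_cvge _ _ _ _ (cst 0%E) _ (fun k => C%:E * lorentz_norm p r (F k))%E).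
- by apply: nearW => k; rewrite lorentz_norm_ge0/= (le_trans (fG k) (GF k)).
- exact: cvg_cst.
rewrite -[X in _ --> X](mule0 C%:E); apply: cvgeMl; first by [].
by rewrite rE in Ffin *; exact: lorentz_norm_cube_sum_tail.
Qed.
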